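(* Let $E/\mathbb{Q}$ be an elliptic curve. Then $E(\mathbb{Q}_{D_4})_{\mathrm{tors}} = E(\mathbb{Q}(D_4^\infty))_{\mathrm{tors}}$.
   Context: Fix an algebraic closure $\overline{\mathbb{Q}}$ of $\mathbb{Q}$; all number fields are viewed inside it. $D_4$ is the dihedral group of order $8$. $\mathbb{Q}_{D_4}$ denotes the compositum (inside $\overline{\mathbb{Q}}$) of all Galois extensions $K/\mathbb{Q}$ with $\operatorname{Gal}(K/\mathbb{Q})\simeq D_4$. A finite group is of generalized $D_4$-type if it is isomorphic to a quotient of a subgroup of a finite direct product $D_4\times\cdots\times D_4$. A number field $K$ is a generalized $D_4$ extension of $\mathbb{Q}$ if the Galois group over $\mathbb{Q}$ of its Galois closure is of generalized $D_4$-type. $\mathbb{Q}(D_4^\infty)$ denotes the compositum of all generalized $D_4$ extensions of $\mathbb{Q}$. For a field $F\subseteq\overline{\mathbb{Q}}$, $E(F)_{\mathrm{tors}}$ is the torsion subgroup of $E(F)$. *)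

(* Defs.v *)
From HB Require Import structures.
From mathcomp Require Import all_boot all_order all_algebra.
From mathcomp Require Import all_fingroup all_solvable all_field.

Set Implicit Arguments.
Unset Strict Implicit.
Unset Printing Implicit Defensive.

Import GRing.Theory.

Local Open Scope ring_scope.

(* The fixed algebraic closure of Q is algC: it is algebraically closed and
   each of its elements is algebraic over Q. Subfields of it may be infinite
   over Q, so they are Prop-valued predicates. *)

Record is_subfield (F : algC -> Prop) : Prop := IsSubfield {
  subfield1 : F 1;
  subfieldB : forall x y, F x -> F y -> F (x - y);
  subfieldM : forall x y, F x -> F y -> F (x * y);
  subfieldV : forall x, F x -> F x^-1
}.

Definition compositum (S : (algC -> Prop) -> Prop) : algC -> Prop :=
  fun x => forall F : algC -> Prop, is_subfield F ->
    (forall K, S K -> forall y, K y -> F y) -> F x.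

Definition is_copy_of (K : algC -> Prop) (M : fieldExtType rat) : Prop :=
  exists f : {rmorphism M -> algC}, forall x, K x <-> exists y : M, x = f y.

(* In MathComp the dihedral group is indexed by its order: the D_4 of the
   mathematical text is 'D_8. *)

Definition D4_field (K : algC -> Prop) : Prop :=
  exists L : splittingFieldType rat,
    [/\ is_copy_of K L, galois 1%AS {:L}%AS
      & ('Gal({:L} / 1%AS) \isog 'D_8)%g].

Definition Q_D4 : algC -> Prop := compositum D4_field.

Definition generalized_D4_type (gT : finGroupType) (G : {group gT}) : Prop :=
  exists (n : nat) (H N : {group {dffun forall i : 'I_n, gsort 'D_8}}),
    (N <| H)%g /\ (G \isog H / N)%g.

Definition is_galois_closure (M : fieldExtType rat) (L : splittingFieldType rat)
    (f : {rmorphism M -> L}) : Prop :=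
  galois 1%AS {:L}%AS /\
  forall E : {subfield L}, (forall x, f x \in E) -> galois 1%AS E ->
    E = {:L}%AS.

Definition generalized_D4_extension (M : fieldExtType rat) : Prop :=
  exists (L : splittingFieldType rat) (f : {rmorphism M -> L}),
    is_galois_closure f /\ generalized_D4_type 'Gal({:L} / 1%AS)%G.

Definition generalized_D4_field (K : algC -> Prop) : Prop :=
  exists M : fieldExtType rat, is_copy_of K M /\ generalized_D4_extension M.

Definition Q_D4_infty : algC -> Prop := compositum generalized_D4_field.

(* y^2 + a1 x y + a3 y = x^3 + a2 x^2 + a4 x + a6 *)
Record weierstrass (F : Type) := Weierstrass
  { wa1 : F; wa2 : F; wa3 : F; wa4 : F; wa6 : F }.

Definition map_weierstrass (F F' : Type) (f : F -> F') (W : weierstrass F) :=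
  Weierstrass (f (wa1 W)) (f (wa2 W)) (f (wa3 W)) (f (wa4 W)) (f (wa6 W)).

Definition discriminant (F : fieldType) (W : weierstrass F) : F :=
  let: Weierstrass a1 a2 a3 a4 a6 := W in
  let b2 := a1 ^+ 2 + 4%:R * a2 in
  let b4 := 2%:R * a4 + a1 * a3 in
  let b6 := a3 ^+ 2 + 4%:R * a6 in
  let b8 := a1 ^+ 2 * a6 + 4%:R * a2 * a6 - a1 * a3 * a4
            + a2 * a3 ^+ 2 - a4 ^+ 2 in
  - b2 ^+ 2 * b8 - 8%:R * b4 ^+ 3 - 27%:R * b6 ^+ 2 + 9%:R * b2 * b4 * b6.

Record elliptic_curve (F : fieldType) := EllipticCurve {
  ec_weierstrass :> weierstrass F;
  _ : discriminant ec_weierstrass != 0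
}.

Inductive point (F : Type) := Infinity | Affine (x y : F).
Arguments Infinity {F}.

Definition on_curve (F : fieldType) (W : weierstrass F) (P : point F) : Prop :=
  let: Weierstrass a1 a2 a3 a4 a6 := W in
  if P is Affine x y then
    y ^+ 2 + a1 * x * y + a3 * y = x ^+ 3 + a2 * x ^+ 2 + a4 * x + a6
  else True.

(* The chord-tangent law; y = lam x + nu is the line through the two points
   (the tangent line if they coincide). Only meaningful on points of W. *)
Definition addp (F : fieldType) (W : weierstrass F) (P Q : point F) : point F :=
  let: Weierstrass a1 a2 a3 a4 a6 := W in
  match P, Q with
  | Infinity, _ => Q
  | _, Infinity => P
  | Affine x1 y1, Affine x2 y2 =>
    if (x1 == x2) && (y1 + y2 + a1 * x2 + a3 == 0) then Infinity else
    let d := 2%:R * y1 + a1 * x1 + a3 in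
    let lam := if x1 == x2
      then (3%:R * x1 ^+ 2 + 2%:R * a2 * x1 + a4 - a1 * y1) / d
      else (y2 - y1) / (x2 - x1) in
    let nu := y1 - lam * x1 in
    let x3 := lam ^+ 2 + a1 * lam - a2 - x1 - x2 in
    Affine x3 (- (lam + a1) * x3 - nu - a3)
  end.

Definition mulp (F : fieldType) (W : weierstrass F) (n : nat) (P : point F) :
    point F := iter n (addp W P) Infinity.

Definition coords_in (F : algC -> Prop) (P : point algC) : Prop :=
  if P is Affine x y then F x /\ F y else True.

(* Membership of P in E(F)_tors, for a subfield F of algC. *)
Definition torsion_point (E : elliptic_curve rat) (F : algC -> Prop)
    (P : point algC) : Prop :=
  let EC := map_weierstrass (@ratr algC) E in
  [/\ on_curve EC P, coords_in F P
    & exists2 n : nat, (0 < n)%N & mulp EC n P = Infinity].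

(* Main.v *)
(** [Q_D4] and [Q_D4_infty] are the same field. In a group of generalized
    D_4-type squares are central of order at most 2, so every generalized D_4
    field is contained in a field generated by elements [theta] whose square
    lies in a multiquadratic field [K], with [K(theta)] Galois over Q. Such an
    extension is classified by a quadratic form on [Gal(K/Q)], that is, by a sum
    of symbols {a, b} whose image in Br(Q) vanishes, and the D_4 extensions
    give exactly the pure symbols {a, b} that vanish in Br(Q). That the former are
    sums of the latter is Tate's computation of [K_2(Q)/2]: one removes the
    largest prime [p] involved. The coefficient [c] of [p] must be a square modulo
    [p] (tame symbol, here obtained from a Frobenius automorphism and Hensel's
    lemma), and then {p, c} is a sum of Steinberg symbols {a, 1 - a} and of symbols
    in smaller primes. The remaining case, with no prime left, is settled
    by complex conjugation. *)

From HB Require Import structures.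
From mathcomp Require Import all_boot all_order all_algebra.
From mathcomp Require Import all_fingroup all_solvable all_field.
From mathcomp Require Import ring zify.
From Stdlib Require Import Classical.
Require Import Defs.

Set Implicit Arguments.
Unset Strict Implicit.
Unset Printing Implicit Defensive.

Import Order.TTheory GRing.Theory Num.Theory.

Local Open Scope ring_scope.

(** No Brauer group is constructed: a vanishing sum of symbols is carried by an actual element
    [theta], through the quotients [s theta / theta] for [s : aut]. Adding symbols is multiplying
    such elements, and since only membership in [Q_D4] matters, each step may divide by a nonzero
    element already known to lie there. When [tau] moves only the square root of the largest prime
    [p] among the generators, the coefficient [c] of [p] is read off from the sign by which [tau]
    changes [s theta / theta]. A symbol {a, 1 - a} is carried by the square root of 1 + sqrt a,
    because 1 + sqrt a has norm 1 - a. The residue condition on [c] is a parity argument: otherwise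
    a Frobenius [phi] with [phi (sq c) = - sq c] yields [b] such that [p * (b * phi b)] is 1 or -1,
    whereas norms from an unramified quadratic extension have even valuation at [p]. Symbols {a, b}
    with a, b or ab a square do not give dihedral groups, so square roots of rationals need an
    argument of their own: they are squares of fourth roots. *)

Local Notation aut := {rmorphism algC -> algC}.

(** * Galois theory in the algebraic numbers *)

Lemma splitting_rat_galois (L : splittingFieldType rat) :
  galois 1%AS {:L}%AS.
Proof.
rewrite /galois sub1v normalFieldf andbT /=.
apply/separableP => y _; apply: pcharf0_separable => p.
by rewrite (fmorph_pchar (GRing.in_alg L)) pchar_num.
Qed.

Lemma splitting_field_of_roots (p : {poly rat}) (s : seq algC) :
    p != 0 -> (map_poly ratr p : {poly algC}) %= \prod_(z <- s) ('X - z%:P) ->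
  exists (L : splittingFieldType rat) (g : {rmorphism L -> algC}) (r : seq L),
    map g r = s /\ <<1 & r>>%VS = fullv.
Proof.
move=> p0 Dp; have [Qs [g [r Dr genr]]] := num_field_exists s.
have Qax : FieldExt_isSplittingField _ Qs.
  constructor; exists (map_poly (GRing.in_alg Qs) p).
    by apply/polyOverP=> i; rewrite coef_map /= memvZ ?mem1v.
  exists r => //; rewrite -(eqp_map g) rmorph_prod -map_poly_comp.
  rewrite (_ : \prod_(i <- r) _ = \prod_(z <- s) ('X - z%:P)); last first.
    by rewrite -Dr big_map; apply: eq_bigr => i _; rewrite /= map_polyXsubC.
  rewrite (eq_map_poly (g := ratr)) // => a /=.
  by rewrite alg_num_field fmorph_rat.
exists (HB.pack_for (splittingFieldType rat) Qs Qax), g, r.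
by [].
Qed.

Lemma subfield_rat (K : algC -> Prop) (a : rat) : is_subfield K -> K (ratr a).
Proof.
case=> K1 KB KM KV.
have K0 : K 0 by rewrite -(subrr 1); apply: KB.
have KD x y : K x -> K y -> K (x + y).
  by move=> Kx Ky; rewrite -[y]opprK -[- y]sub0r; apply/KB/KB.
have Kn (n : nat) : K n%:R by elim: n => // n IHn; rewrite -natr1; apply: KD.
have Kz (m : int) : K m%:~R.
  case: m => n; first exact: Kn.
  by rewrite NegzE rmorphN /= -sub0r; apply: KB => //; apply: Kn.
by rewrite /ratr; apply: KM; last apply: KV; apply: Kz.
Qed.

(** Galois correspondence for automorphisms of the whole of [algC]: [x] and [s] are placed in a
    finite normal extension of Q, each of whose automorphisms extends to [algC], so the finite
    correspondence puts [x] in the field generated by [s]. [K] itself may be infinite over Q. *)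
Lemma fixed_subfield (K : algC -> Prop) (s : seq algC) (x : algC) :
    is_subfield K -> {in s, forall y, K y} ->
    (forall nu : {rmorphism algC -> algC}, {in s, forall y, nu y = y} ->
      nu x = x) ->
  K x.
Proof.
move=> sfK sK fix_x.
pose p : {poly rat} := \prod_(y <- x :: s) sval (minCpolyP y).
have p0 : p != 0.
  rewrite prodf_seq_neq0; apply/allP => y _ /=.
  by case: minCpolyP => q /= [_ /monic_neq0].
have [r Dr] := closed_field_poly_normal (map_poly ratr p : {poly algC}).
have [||L [g [r1 [Dr1 _]]]] := @splitting_field_of_roots p r => //.
  by rewrite Dr eqp_scale // lead_coef_eq0 map_poly_eq0.
have gP y : y \in x :: s -> exists z, y = g z.
  move=> xsy; have: y \in r.
    rewrite -root_prod_XsubC -(rootZ _ _ (a := lead_coef (map_poly ratr p))).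
      rewrite -Dr rmorph_prod /root horner_prod (big_rem y) //=.
      by case: minCpolyP => q /= [<- _ _]; rewrite (rootP (root_minCpoly y)) mul0r.
    by rewrite lead_coef_eq0 map_poly_eq0.
  by rewrite -Dr1 => /mapP[z _ ->]; exists z.
have [x1 Dx] := gP x (mem_head _ _).
have [s1 Ds] : exists s1, s = map g s1.
  have: {in s, forall y, exists z, y = g z}.
    by move=> y sy; apply: gP; rewrite inE sy orbT.
  elim: s {gP sK fix_x p p0 Dr Dx} => [|y s IHs] gs; first by exists [::].
  have [z Dz] := gs y (mem_head _ _).
  have [t Dt] := IHs (fun u su => gs u (mem_behead (s := y :: s) su)).
  by exists (z :: t); rewrite /= Dt Dz.
have [E DE] : exists E : {subfield L}, E = <<1 & s1>>%AS by exists <<1 & s1>>%AS.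
have Ex1 : x1 \in E.
  have galE : galois E {:L}%AS.
    by apply: galoisS (splitting_rat_galois L); rewrite sub1v subvf.
  rewrite -(galois_fixedField galE); apply/fixedFieldP; rewrite ?memvf // => h.
  move/(fixed_gal (subvf _)) => fixh.
  have [nu Dnu] := extend_algC_subfield_aut g h.
  apply: (fmorph_inj g); rewrite Dnu -Dx; apply: fix_x => y.
  rewrite Ds => /mapP[z s1z ->]; rewrite -Dnu; congr (g _); apply: fixh.
  by rewrite DE; apply: seqv_sub_adjoin.
pose KL : L -> Prop := fun z => K (g z).
suff: forall z, z \in <<1 & s1>>%VS -> K (g z).
  by rewrite Dx; apply; rewrite DE in Ex1.
have: {in s1, forall z, K (g z)} by move=> z s1z; apply: sK; rewrite Ds map_f.
clear -sfK; case: (sfK) => _ KB KM KV.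
have KD u v : K u -> K v -> K (u + v).
  have K0 : K 0 by have := subfield_rat 0 sfK; rewrite rmorph0.
  by move=> Ku Kv; rewrite -[v]opprK -[- v]sub0r; apply/KB/KB.
elim/last_ind: s1 => [|t z IHt] Kt y.
  rewrite Fadjoin_nil => /vlineP[a ->]; rewrite alg_num_field fmorph_rat.
  exact: subfield_rat.
rewrite adjoin_rcons => /Fadjoin_polyP[q /polyOverP Kq ->].
rewrite horner_coef rmorph_sum; elim/big_ind: _ => [|u v|i _]; last first.
- rewrite rmorphM rmorphXn; apply: KM.
    by apply: IHt (Kq i) => u tu; apply: Kt; rewrite mem_rcons inE tu orbT.
  elim: (val i) => [|n IHn]; first exact: subfield1 sfK.
  by rewrite exprS; apply: (subfieldM sfK) => //; apply: Kt;
     rewrite mem_rcons mem_head.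
- exact: KD.
by have := subfield_rat 0 sfK; rewrite rmorph0.
Qed.

(** * Multiquadratic fields *)

Lemma subfield_int (K : algC -> Prop) (m : int) : is_subfield K -> K m%:~R.
Proof. by move/(subfield_rat m%:~R); rewrite ratr_int. Qed.

Lemma subfield_nat (K : algC -> Prop) (n : nat) : is_subfield K -> K n%:R.
Proof. exact: (@subfield_int K n). Qed.

Lemma subfieldN (K : algC -> Prop) x : is_subfield K -> K x -> K (- x).
Proof.
by move=> sfK Kx; rewrite -sub0r; apply: subfieldB => //; apply: (subfield_nat 0).
Qed.

Lemma subfieldD (K : algC -> Prop) x y : is_subfield K -> K x -> K y -> K (x + y).
Proof.
by move=> sfK Kx Ky; rewrite -[y]opprK; apply: subfieldB => //; apply: subfieldN.
Qed.

Lemma subfield_div (K : algC -> Prop) x y : is_subfield K -> K x -> K y -> K (x / y).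
Proof. by move=> sfK Kx Ky; apply: subfieldM => //; apply: subfieldV. Qed.

Lemma subfieldX (K : algC -> Prop) x n : is_subfield K -> K x -> K (x ^+ n).
Proof.
move=> sfK Kx; elim: n => [|n IHn]; first exact: subfield1.
by rewrite exprS; apply: subfieldM.
Qed.

Lemma Crat_subfield : is_subfield (fun x => x \in Crat).
Proof.
by split=> *; rewrite ?rpredB ?rpredM ?rpredV ?rpred1.
Qed.

(* [K + K s], which is the field [K(s)] only when [s^2] lies in [K]. *)
Definition adjoin (K : algC -> Prop) (s x : algC) : Prop :=
  exists a b, [/\ K a, K b & x = a + b * s].

Lemma adjoin_base (K : algC -> Prop) s x : is_subfield K -> K x -> adjoin K s x.
Proof.
by move=> sfK Kx; exists x, 0; split=> //; [apply: (subfield_nat 0) | ring].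
Qed.

Lemma adjoin_gen (K : algC -> Prop) s : is_subfield K -> adjoin K s s.
Proof.
move=> sfK; exists 0, 1; split; [exact: (subfield_nat 0)|exact: subfield1|ring].
Qed.

Lemma adjoin_sub (K K' : algC -> Prop) s x :
  is_subfield K' -> (forall y, K y -> K' y) -> K' s -> adjoin K s x -> K' x.
Proof.
move=> sfK' sK K's [a [b [Ka Kb ->]]].
by apply: subfieldD (sK _ Ka) _ => //; apply: subfieldM => //; apply: sK.
Qed.

Lemma adjoin_uniq (K : algC -> Prop) s a b :
  is_subfield K -> ~ K s -> K a -> K b -> a + b * s = 0 -> a = 0 /\ b = 0.
Proof.
move=> sfK nKs Ka Kb ab0; have [b0 | b0] := eqVneq b 0.
  by move: ab0; rewrite b0 mul0r addr0.
case: nKs; rewrite (_ : s = - a / b); last first.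
  apply: (mulIf b0); rewrite divfK // mulrC.
  by move/eqP: ab0; rewrite addrC addr_eq0 => /eqP.
by apply: subfield_div => //; apply: subfieldN.
Qed.

Lemma adjoin_subfield (K : algC -> Prop) s :
  is_subfield K -> K (s ^+ 2) -> is_subfield (adjoin K s).
Proof.
move=> sfK Ks2; split=> [|x y [a [b [Ka Kb ->]]] [c [d [Kc Kd ->]]]
    |x y [a [b [Ka Kb ->]]] [c [d [Kc Kd ->]]]|x [a [b [Ka Kb ->]]]].
- by apply: adjoin_base => //; apply: subfield1.
- by exists (a - c), (b - d); split; [apply: subfieldB|apply: subfieldB|ring].
- exists (a * c + b * d * s ^+ 2), (a * d + b * c).
  by split; [apply: subfieldD => //; do 2?apply: subfieldM => //
    |apply: subfieldD => //; apply: subfieldM => //|ring].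
have [Ks | nKs] := classic (K s).
  apply: adjoin_base => //; apply: subfieldV => //.
  by apply: subfieldD => //; apply: subfieldM.
have [ab0 | ab0] := eqVneq (a + b * s) 0.
  by rewrite ab0 invr0; apply: adjoin_base => //; apply: (subfield_nat 0).
have N0 : a - b * s != 0.
  apply: contra ab0 => /eqP ab0.
  have [|a0 b0] := @adjoin_uniq K s a (- b) sfK nKs Ka (subfieldN sfK Kb).
    by rewrite mulNr.
  by move/eqP: b0; rewrite oppr_eq0 => /eqP ->; rewrite a0 mul0r addr0.
pose N := a ^+ 2 - b ^+ 2 * s ^+ 2.
have DN : N = (a + b * s) * (a - b * s) by rewrite /N; ring.
have KN : K N.
  by apply: subfieldB => //; [|apply: subfieldM => //]; apply: subfieldX.
exists (a / N), (- b / N); split; first exact: subfield_div.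
  by apply: subfield_div => //; apply: subfieldN.
by rewrite mulrAC -mulrDl mulNr DN invfM mulrCA mulfV // mulr1.
Qed.

Definition sq (d : int) : algC := sqrtC d%:~R.

Lemma sqK d : sq d ^+ 2 = d%:~R.
Proof. exact: sqrtCK. Qed.

Lemma sqr_eq_sign (F : idomainType) (x y : F) :
  x ^+ 2 = y ^+ 2 -> x = y \/ x = - y.
Proof. by move/eqP; rewrite eqf_sqr => /orP[] /eqP; [left|right]. Qed.

Definition msq (ds : seq int) : algC -> Prop :=
  foldr (fun d K => adjoin K (sq d)) (fun x => x \in Crat) ds.

Lemma msq_subfield ds : is_subfield (msq ds).
Proof.
elim: ds => [|d ds IH]; first exact: Crat_subfield.
by apply: adjoin_subfield => //; rewrite sqK; apply: subfield_int.
Qed.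
#[global] Hint Resolve msq_subfield : core.

Lemma msq_gen ds d : d \in ds -> msq ds (sq d).
Proof.
elim: ds => // e ds IH; rewrite inE => /predU1P[->|/IH].
  exact: adjoin_gen.
exact: adjoin_base.
Qed.

Lemma msq_min ds (K : algC -> Prop) x :
  is_subfield K -> {in ds, forall d, K (sq d)} -> msq ds x -> K x.
Proof.
move=> sfK; elim: ds x => [|d ds IH] x Kds /=.
  by case/CratP=> a ->; apply: subfield_rat.
apply: adjoin_sub => //; last exact: Kds (mem_head _ _).
by move=> y; apply: IH => e dse; apply: Kds; rewrite inE dse orbT.
Qed.

Lemma aut_sq (nu : {rmorphism algC -> algC}) z (d : int) :
  z ^+ 2 = d%:~R -> nu z = z \/ nu z = - z.
Proof.
by move=> Dz; apply: sqr_eq_sign; rewrite -rmorphXn Dz rmorph_int.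
Qed.

Lemma fixed_subfieldP (nu : {rmorphism algC -> algC}) :
  is_subfield (fun x => nu x = x).
Proof.
split=> [|x y xK yK|x y xK yK|x xK].
- exact: rmorph1.
- by rewrite rmorphB xK yK.
- by rewrite rmorphM xK yK.
by rewrite fmorphV xK.
Qed.

Lemma msq_fix ds (nu : {rmorphism algC -> algC}) x :
  {in ds, forall d, nu (sq d) = sq d} -> msq ds x -> nu x = x.
Proof.
move=> fixds; apply: (msq_min (K := fun y => nu y = y)) => //.
exact: fixed_subfieldP.
Qed.

Lemma preim_subfield (K : algC -> Prop) (nu : {rmorphism algC -> algC}) :
  is_subfield K -> is_subfield (fun x => K (nu x)).
Proof.
move=> sfK; split=> [|x y xK yK|x y xK yK|x xK].
- by rewrite rmorph1; apply: subfield1.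
- by rewrite rmorphB; apply: subfieldB.
- by rewrite rmorphM; apply: subfieldM.
by rewrite fmorphV; apply: subfieldV.
Qed.

Lemma msq_stable ds (nu : {rmorphism algC -> algC}) x : msq ds x -> msq ds (nu x).
Proof.
apply: (msq_min (K := fun y => msq ds (nu y))) => [|d dsd]; first exact: preim_subfield.
have [->|->] := aut_sq nu (sqK d); first exact: msq_gen.
by apply: subfieldN => //; apply: msq_gen.
Qed.

(** If every automorphism fixing [msq ds] also fixed [sq d], then [fixed_subfield] would put [sq d]
    in [msq ds]. *)
Lemma msq_flip ds d :
    ~ msq ds (sq d) ->
  exists nu : {rmorphism algC -> algC},
    (forall x, msq ds x -> nu x = x) /\ nu (sq d) = - sq d.
Proof.
move=> nds; apply: NNPP => noflip; apply: nds.
apply: (fixed_subfield (s := map sq ds)) => // [_ /mapP[e dse ->]|nu fix_nu].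
  exact: msq_gen.
have [//|Nd] := aut_sq nu (sqK d); case: noflip; exists nu; split=> // x.
by apply: msq_fix => e dse; apply: fix_nu; apply: map_f.
Qed.

(** A triangular form of independence modulo rational squares, suited to induction along the tower
    [msq]. *)
Fixpoint indep (ds : seq int) : Prop :=
  if ds is d :: ds' then ~ msq ds' (sq d) /\ indep ds' else True.

Lemma indep_aut ds (eps : int -> bool) :
    indep ds ->
  exists nu : {rmorphism algC -> algC},
    {in ds, forall d, nu (sq d) = (-1) ^+ eps d * sq d}.
Proof.
elim: ds => [|d ds IH] /=; first by exists idfun.
case=> nds /IH[nu Dnu].
have [flip [fixf Df]] := msq_flip nds.
have [Dd|Dd] : nu (sq d) = (-1) ^+ eps d * sq d
             \/ nu (sq d) = - ((-1) ^+ eps d * sq d).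
- by have [->|->] := aut_sq nu (sqK d); case: (eps d);
     rewrite ?expr1 ?mulN1r ?expr0 ?mul1r ?opprK; auto.
- by exists nu => e; rewrite inE => /predU1P[->|/Dnu].
exists (nu \o flip) => e; rewrite inE => /predU1P[->|dse] /=.
  by rewrite Df rmorphN Dd opprK.
by rewrite fixf ?Dnu //; apply: msq_gen.
Qed.

Lemma sqM_sign d e : sq (d * e) = sq d * sq e \/ sq (d * e) = - (sq d * sq e).
Proof. by apply: sqr_eq_sign; rewrite exprMn !sqK rmorphM. Qed.

(** Squaring sqrt d = a + b sqrt e, with sqrt e outside the smaller field, forces a = 0 or b = 0. So
    sqrt d or sqrt (de) lies in the smaller field, and the valuation of de at [p] is still odd. Over
    Q the parity of the valuation concludes. *)
Lemma odd_logn_msq (p : nat) ds (d : int) :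
    prime p -> odd (logn p `|d|) -> all (fun e : int => ~~ (p %| `|e|)%N) ds ->
  ~ msq ds (sq d).
Proof.
move=> pr_p; elim: ds d => [|e ds IH] d odd_d /=.
  move=> _ /CratP[a Da].
  have Eda: (numq a ^+ 2 = d * denq a ^+ 2)%R.
    apply/eqP; rewrite -(eqr_int algC) [X in _ == X]rmorphM !rmorphXn /= -(sqK d) Da /ratr.
    by rewrite -exprMn divfK // intr_eq0 denq_neq0.
  have {}Eda: (`|numq a| ^ 2 = `|d| * `|denq a| ^ 2)%N.
    by rewrite -!abszX -abszM -Eda.
  have d0 : (0 < `|d|)%N.
    by rewrite lt0n; apply: contraL odd_d => /eqP->; rewrite logn0.
  have q0 : (0 < `|denq a| ^ 2)%N by rewrite expn_gt0 absz_gt0 denq_neq0.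
  move/(congr1 (fun n => odd (logn p n))): Eda.
  by rewrite lognM // oddD !lognX !oddM odd_d.
case/andP=> pe pds [a [b [dsa dsb Dd]]].
have [dse | ndse] := classic (msq ds (sq e)).
  apply: (IH d odd_d pds); rewrite Dd.
  by apply: subfieldD => //; apply: subfieldM.
have [|||_ /eqP] := @adjoin_uniq _ _ (a ^+ 2 + b ^+ 2 * e%:~R - d%:~R) (2 * a * b)
    (msq_subfield ds) ndse.
- apply: subfieldB (subfield_int _ _) => //; apply: subfieldD => //.
    exact: subfieldX.
  by apply: subfieldM (subfield_int _ _) => //; apply: subfieldX.
- by do 2?apply: subfieldM => //; apply: (subfield_nat 2).
- by rewrite -!sqK Dd; ring.
rewrite !mulf_eq0 pnatr_eq0 /= => /orP[] /eqP c0; last first.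
  by apply: (IH d odd_d pds); rewrite Dd c0 mul0r addr0.
have e0 : (0 < `|e|)%N by rewrite lt0n; apply: contraNneq pe => ->.
have d0 : (0 < `|d|)%N.
  by rewrite lt0n; apply: contraL odd_d => /eqP->; rewrite logn0.
apply: (IH (d * e) _ pds).
  by rewrite abszM lognM // [logn p `|e|]lognE pr_p e0 (negPf pe) addn0.
have dsde : msq ds (sq d * sq e).
  rewrite Dd c0 add0r -mulrA -expr2 sqK.
  by apply: subfieldM => //; apply: subfield_int.
by have [->|->] := sqM_sign d e => //; apply: subfieldN.
Qed.

(** * D_4 extensions *)

Lemma compositum_subfield S : is_subfield (compositum S).
Proof.
split=> [F sfF _|x y Sx Sy F sfF SF|x y Sx Sy F sfF SF|x Sx F sfF SF].
- exact: subfield1.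
- by apply: subfieldB (Sx _ _ _) (Sy _ _ _).
- by apply: subfieldM (Sx _ _ _) (Sy _ _ _).
by apply: subfieldV (Sx _ _ _).
Qed.

Lemma gal_gen_eq (L : splittingFieldType rat) (r : seq L) (u v : gal_of {:L}%AS) :
  <<1 & r>>%VS = fullv -> {in r, u =1 v} -> u = v.
Proof.
move=> genr uvr; apply/eqP/gal_eqP => z _.
have [w Dw] : exists w, w = (v * u^-1)%g by exists (v * u^-1)%g.
have fixw : (<<1 & r>> <= fixedSpace_aspace w)%VS.
  apply/Fadjoin_seqP; split=> [|y ry]; first exact: sub1v.
  apply/fixedSpaceP; rewrite Dw galM ?memvf // -uvr // -galM ?memvf //.
  by rewrite mulgV gal_id.
have: z \in fixedSpace_aspace w by apply: (subvP fixw); rewrite genr memvf.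
have -> : v = (w * u)%g by rewrite Dw mulgKV.
by move/fixedSpaceP; rewrite galM ?memvf // => ->.
Qed.

Lemma two_neq0 (L : fieldExtType rat) : 2%:R != 0 :> L.
Proof. by rewrite -(rmorph_nat (GRing.in_alg L)) fmorph_eq0 pnatr_eq0. Qed.

(** Here [h] and [k] play the square roots of the conjugates x + y sqrt a and x - y sqrt a, with
    [al] = sqrt a and [t] = sqrt b. As [rho] negates [al] and [t], it exchanges [h] and [k] up to
    signs whose product is -1, so its square is -1 on both and its order is 4. As [s] fixes [al] and
    negates [t], it negates exactly one of [h] and [k]: it is an involution inverting [rho]. *)
Lemma gal_dihedral8 (L : splittingFieldType rat) (h k al t : L)
    (rho s : gal_of {:L}%AS) :
    <<1 & [:: h; k]>>%VS = fullv ->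
    [/\ h != 0, k != 0, al != 0 & t = h * k] ->
    (forall u : gal_of {:L}%AS, [/\ u al = al -> u h = h \/ u h = - h,
       u al = - al -> u h = k \/ u h = - k,
       u al = al \/ u al = - al & u t = t \/ u t = - t]) ->
    rho al = - al -> rho t = - t -> s al = al -> s t = - t ->
  ('Gal({:L} / 1%AS) \isog 'D_8)%g.
Proof.
move=> genL [h0 k0 al0 Dt] act ra rt sa st.
have eqg (u v : gal_of {:L}%AS) : u h = v h -> u k = v k -> u = v.
  by move=> uvh uvk; apply: (gal_gen_eq genL) => y; rewrite !inE => /orP[]/eqP->.
have Dk (u : gal_of {:L}%AS) : u k = u t / u h.
  by rewrite Dt rmorphM /= mulrAC mulfV ?mul1r // fmorph_eq0.
have nopp (z : L) : z != 0 -> z != - z.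
  by move=> z0; rewrite -addr_eq0 -mulr2n -mulr_natl mulf_neq0 // two_neq0.
have t0 : t != 0 by rewrite Dt mulf_neq0.
have [b rh rk] : exists2 b : bool, rho h = (-1) ^+ b * k & rho k = - (-1) ^+ b * h.
  have [_ /(_ ra) Drh _ _] := act rho.
  by case: Drh => Drh; [exists false | exists true];
    rewrite ?Dk ?rt ?Drh ?expr0 ?expr1 ?mul1r ?mulN1r ?Dt //; field; rewrite ?oppr_eq0 ?h0 ?k0.
have [c sh sk] : exists2 c : bool, s h = (-1) ^+ c * h & s k = - (-1) ^+ c * k.
  have [/(_ sa) Dsh _ _ _] := act s.
  by case: Dsh => Dsh; [exists false | exists true];
    rewrite ?Dk ?st ?Dsh ?expr0 ?expr1 ?mul1r ?mulN1r ?Dt //; field; rewrite ?oppr_eq0 ?h0 ?k0.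
have r2h : (rho ^+ 2)%g h = - h.
  by rewrite galM ?memvf // rh rmorphM rmorph_sign /= rk mulNr mulrN signrMK.
have r2k : (rho ^+ 2)%g k = - k.
  by rewrite galM ?memvf // rk rmorphM rmorphN rmorph_sign /= rh mulNr signrMK.
have r4 : (rho ^+ 4)%g = 1%g.
  rewrite (expgM _ 2 2); apply: eqg; rewrite gal_id.
    by rewrite [LHS]galM ?memvf // r2h rmorphN /= r2h opprK.
  by rewrite [LHS]galM ?memvf // r2k rmorphN /= r2k opprK.
have s2 : (s ^+ 2)%g = 1%g.
  apply: eqg; rewrite gal_id galM ?memvf //.
    by rewrite sh rmorphM rmorph_sign /= sh signrMK.
  by rewrite sk rmorphM rmorphN rmorph_sign /= sk mulrA mulrNN -mulrA signrMK.
have rsr : (rho * s * rho)%g = s.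
  apply: eqg; rewrite !galM ?memvf //.
    rewrite rh !rmorphM !rmorph_sign /= sk rmorphM rmorphN !rmorph_sign /= rk sh.
    by case: b {rh rk}; case: c {sh sk}; rewrite ?expr0 ?expr1; ring.
  rewrite rk !rmorphM !rmorphN !rmorph_sign /= sh rmorphM !rmorph_sign /= rh sk.
  by case: b {rh rk}; case: c {sh sk}; rewrite ?expr0 ?expr1; ring.
pose M := (<[rho]> <*> <[s]>)%g.
have Mr : rho \in M by rewrite mem_gen // inE cycle_id.
have Ms : s \in M by rewrite mem_gen // inE cycle_id orbT.
have M1 (u : gal_of {:L}%AS) : u al = al -> u t = t -> u \in M.
  move=> ua ut; have [/(_ ua) uh _ _ _] := act u.
  case: uh => uh.
    suff -> : u = 1%g by apply: group1.
    by apply: eqg; rewrite gal_id // Dk uh ut Dt; field; rewrite h0.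
  suff -> : u = (rho ^+ 2)%g by apply: groupX.
  by apply: eqg; rewrite ?r2h ?r2k // Dk uh ut Dt; field; rewrite ?oppr_eq0 h0.
have M2 (u : gal_of {:L}%AS) : u al = al -> u \in M.
  move=> ua; have [_ _ _ [ut|ut]] := act u; first exact: M1.
  rewrite -(groupMr _ Ms); apply: M1; rewrite galM ?memvf //.
    by rewrite ua sa.
  by rewrite ut rmorphN /= st opprK.
have defG : 'Gal({:L} / 1%AS)%g = M.
  apply/eqP; rewrite eqEsubset; apply/andP; split; apply/subsetP => u _.
    have [_ _ [ua|ua] _] := act u; first exact: M2.
    rewrite -(groupMr _ Mr); apply: M2; rewrite galM ?memvf //.
    by rewrite ua rmorphN /= ra opprK.
  by rewrite gal_kHom ?sub1v // k1HomE ahomWin.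
(* The dihedral relations make the Galois group an image of ['D_8]; its order is at least 8 because
   [rho] has order 4 and [s] is not a power of [rho]. *)
rewrite isogEcard; apply/andP; split.
  rewrite (Grp_2dihedral (n := 3)) //; apply/existsP; exists (rho, s) => /=.
  rewrite !xpair_eqE; apply/and4P; split=> //.
  - by apply/eqP; rewrite defG.
  - by rewrite r4.
  - by rewrite s2.
  have sV : (s^-1 = s)%g by apply/eqP; rewrite eq_invg_mul -expg2 s2.
  by rewrite eq_sym eq_invg_mul /conjg sV !mulgA rsr -expg2 s2.
have D8 : #|[set: gsort 'D_8]| = 8%N := @card_2dihedral 3 isT.
rewrite [leqLHS]D8.
have o4 : order rho = 4%N.
  have : (order rho %| 2 ^ 2)%N by rewrite order_dvdn r4.
  case/(dvdn_pfactor _ _ (isT : prime 2)) => [[|[|[|//]]]] // _ o.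
    have := expg_order rho; rewrite o expg1 => r1.
    by move: (nopp _ al0); rewrite -ra r1 gal_id eqxx.
  have := expg_order rho; rewrite o => r1.
  by move: (nopp _ h0); rewrite -r2h r1 gal_id eqxx.
have sr : s \notin <[rho]>%g.
  apply/cycleP => -[i si].
  have rat j : (rho ^+ j)%g al = (-1) ^+ j * al /\ (rho ^+ j)%g t = (-1) ^+ j * t.
    elim: j => [|j [IHa IHt]]; first by rewrite !gal_id !expr0 !mul1r.
    rewrite expgSr !galM ?memvf // IHa IHt !rmorphM !rmorph_sign /= ra rt.
    by rewrite !exprSr; split; ring.
  have [sa' st'] := rat i; move: sa' st'; rewrite -si sa st => sa'.
  have -> : (-1) ^+ i = 1 :> L by apply: (mulIf al0); rewrite mul1r -sa'.
  by rewrite mul1r => /esym/eqP; apply/negP/nopp.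
have sG : <[rho]>%g \subset 'Gal({:L} / 1%AS)%g by rewrite cycle_subG /= defG.
have := Lagrange sG; rewrite -orderE o4 => <-.
rewrite -[leqLHS]/(4 * 2)%N leq_pmul2l // indexg_gt1.
by apply: contra sr => /subsetP; apply; rewrite /= defG.
Qed.

(** The three conditions exclude the degenerate cases: [b] a square would give an elementary abelian
    group, [a * b] a square a cyclic one. Together they provide automorphisms with prescribed signs
    on sqrt a and sqrt b. *)
Lemma D4_mem (a x y : rat) (eta : algC) :
    let b := x ^+ 2 - a * y ^+ 2 in
    (forall r, r ^+ 2 != a) -> (forall r, r ^+ 2 != b) ->
    (forall r, r ^+ 2 != a * b) ->
    eta ^+ 2 = ratr x + ratr y * sqrtC (ratr a) -> Q_D4 eta.
Proof.
move=> b na nb nab Deta.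
have y0 : y != 0.
  by apply: contraNneq (nb x) => y0; rewrite /b y0 expr0n mulr0 subr0.
pose al := sqrtC (ratr a : algC); pose et2 := sqrtC (ratr x - ratr y * al).
have Dal : al ^+ 2 = ratr a by rewrite sqrtCK.
have Det2 : et2 ^+ 2 = ratr x - ratr y * al by rewrite sqrtCK.
pose p : {poly rat} := ('X ^+ 2 - x%:P) ^+ 2 - (a * y ^+ 2)%:P.
have Dp : map_poly ratr p =
    \prod_(z <- [:: eta; et2; - eta; - et2]) ('X - z%:P) :> {poly algC}.
  rewrite !big_cons big_nil /p rmorphB /= rmorphXn /= rmorphB /= rmorphXn /=.
  rewrite map_polyX !map_polyC /= !polyCN.
  have Day : ratr (a * y ^+ 2) = (ratr y * al) ^+ 2.
    by rewrite exprMn Dal mulrC rmorphM rmorphXn.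
  rewrite [ratr (a * _)]Day.
  transitivity (('X ^+ 2 - (eta ^+ 2)%:P) * ('X ^+ 2 - (et2 ^+ 2)%:P)).
    by rewrite Deta Det2 -/al rmorphXn polyCD polyCB /=; ring.
  by rewrite !rmorphXn /=; ring.
have p0 : p != 0.
  by rewrite -(map_poly_eq0 (ratr : rat -> algC)) Dp monic_neq0 ?monic_prod_XsubC.
have [|L [g [r [Dr genr]]]] := @splitting_field_of_roots p [:: eta; et2; - eta; - et2] p0.
  by rewrite Dp eqpxx.
case: r Dr genr => // h [|k [|h' [|k' []]]] //= [Dh Dk Dh' Dk'] genr.
have {Dh' Dk'}genL : <<1 & [:: h; k]>>%VS = fullv.
  have {Dh'} Dh' : h' = - h by apply: (fmorph_inj g); rewrite rmorphN /= Dh.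
  have {Dk'} Dk' : k' = - k by apply: (fmorph_inj g); rewrite rmorphN /= Dk.
  apply/eqP; rewrite eqEsubv subvf -genr; apply/Fadjoin_seqP; split=> [|z].
    exact: sub1v.
  have hin : h \in <<1 & [:: h; k]>>%VS by apply: seqv_sub_adjoin; rewrite inE eqxx.
  have kin : k \in <<1 & [:: h; k]>>%VS.
    by apply: seqv_sub_adjoin; rewrite !inE eqxx orbT.
  by rewrite !inE Dh' Dk' => /or4P[]/eqP->; rewrite ?rpredN.
have [c Dc] : exists c : {rmorphism rat -> L}, forall z, c z = z%:A.
  by exists (GRing.in_alg L).
have gc z : g (c z) = ratr z by rewrite Dc alg_num_field fmorph_rat.
have uc (u : gal_of {:L}%AS) z : u (c z) = c z by rewrite Dc linearZ rmorph1.
have yL0 : c y != 0 :> L by rewrite fmorph_eq0.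
pose alL : L := (h ^+ 2 - c x) / c y.
have gal_L : g alL = al.
  rewrite /alL fmorph_div rmorphB rmorphXn /= !gc Dh Deta -/al.
  by rewrite addrC addKr mulrC mulKf // fmorph_eq0.
have Dh2 : h ^+ 2 = c x + c y * alL.
  by rewrite mulrCA divff // mulr1 addrC subrK.
have Dk2 : k ^+ 2 = c x - c y * alL.
  apply: (fmorph_inj g); rewrite rmorphXn rmorphB rmorphM /= !gc gal_L.
  by rewrite Dk Det2.
have Dal2 : alL ^+ 2 = c a.
  by apply: (fmorph_inj g); rewrite rmorphXn /= gc gal_L Dal.
have Dt2 : (h * k) ^+ 2 = c b.
  rewrite exprMn Dh2 Dk2 /b rmorphB rmorphXn rmorphM rmorphXn /= -Dal2; ring.
have move_sqrt z q : (forall r, r ^+ 2 != q) -> z ^+ 2 = c q ->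
    exists u : gal_of {:L}%AS, u z = - z.
  move=> nc Dz; apply: NNPP => nou.
  have: z \in 1%AS.
    rewrite -(galois_fixedField (splitting_rat_galois L)).
    apply/fixedFieldP => [|u _]; first exact: memvf.
    have [//|uz] : u z = z \/ u z = - z.
      by apply: sqr_eq_sign; rewrite -rmorphXn Dz /= uc.
    by case: nou; exists u.
  case/vlineP=> r Dr; case/eqP: (nc r); apply: (fmorph_inj c).
  by rewrite rmorphXn /= Dc -Dr Dz.
have nz z q : (forall r, r ^+ 2 != q) -> z ^+ 2 = c q -> z != 0 :> L.
  move=> nc Dz; apply: contraNneq (nc 0) => z0; move/eqP: Dz.
  by rewrite z0 !expr0n /= eq_sym fmorph_eq0 => /eqP ->.
have al0 := nz _ _ na Dal2; have t0 := nz _ _ nb Dt2.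
have [h0 k0] : h != 0 /\ k != 0.
  by split; apply: contraNneq t0 => ->; rewrite ?mul0r ?mulr0.
have sgal z q (u : gal_of {:L}%AS) : z ^+ 2 = c q -> u z = z \/ u z = - z.
  by move=> Dz; apply: sqr_eq_sign; rewrite -rmorphXn Dz /= uc.
(* An automorphism moving [h * k] and one moving [alL * (h * k)] are combined: one of them, or their
   product, has the required signs. *)
have [s [sa st]] : exists s : gal_of {:L}%AS, s alL = alL /\ s (h * k) = - (h * k).
  have [u ut] := move_sqrt _ _ nb Dt2.
  have [ua|ua] := sgal _ _ u Dal2; first by exists u.
  have [|v] := @move_sqrt (alL * (h * k)) _ nab.
    by rewrite exprMn Dal2 Dt2 rmorphM.
  rewrite rmorphM /=; have [va|va] := sgal _ _ v Dal2; rewrite va.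
    by rewrite -mulrN => /(mulfI al0) vt; exists v.
  rewrite mulNr => /oppr_inj /(mulfI al0) vt.
  by exists (u * v)%g; rewrite !galM ?memvf // ua ut !rmorphN /= va vt opprK.
have [rho [ra rt]] : exists r : gal_of {:L}%AS, r alL = - alL /\ r (h * k) = - (h * k).
  have [u ua] := move_sqrt _ _ na Dal2.
  have [ut|ut] := sgal _ _ u Dt2; last by exists u.
  by exists (u * s)%g; rewrite !galM ?memvf // ua ut rmorphN /= sa st.
have isoL : ('Gal({:L} / 1%AS) \isog 'D_8)%g.
  apply: (gal_dihedral8 genL _ _ ra rt sa st) => // u; split.
  - by move=> ua; apply: sqr_eq_sign; rewrite -rmorphXn Dh2 rmorphD rmorphM /= !uc ua.
  - move=> ua; apply: sqr_eq_sign.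
    by rewrite -rmorphXn Dh2 Dk2 rmorphD rmorphM /= !uc ua mulrN.
  - exact: sgal Dal2.
  exact: sgal Dt2.
move=> F sfF /(_ (fun z => exists w, z = g w)); apply; last by exists h.
by exists L; split=> //; [exists g | apply: splitting_rat_galois].
Qed.

(** The case x = 0, y = 1 or -1 of [D4_mem], the sign depending on which square root of [q] is
    [eta ^+ 2]. Then b = -q, and ab = - q^2 is negative, hence not a square. *)
Lemma fourth_root_Q_D4 (q : rat) (eta : algC) :
    (forall r, r ^+ 2 != q) -> (forall r, r ^+ 2 != - q) ->
    eta ^+ 4 = ratr q ->
  Q_D4 eta.
Proof.
move=> nq nNq Deta.
have q0 : q != 0 by apply: contraNneq (nq 0) => ->; rewrite expr0n.
have [y [y1 Dy]] : exists y : rat, y ^+ 2 = 1 /\ eta ^+ 2 = ratr y * sqrtC (ratr q).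
  have [|Dz|Dz] := @sqr_eq_sign algC (eta ^+ 2) (sqrtC (ratr q)).
  - by rewrite -exprM Deta sqrtCK.
  - by exists 1; rewrite expr1n rmorph1 mul1r.
  by exists (-1); rewrite sqrrN expr1n rmorphN1 mulN1r.
have Nq : 0 ^+ 2 - q * y ^+ 2 = - q by rewrite y1; ring.
apply: (@D4_mem q 0 y) => //; rewrite ?Nq //; last by rewrite Dy rmorph0 add0r.
move=> r; rewrite mulrN -expr2.
apply: contraNneq q0 => Dr; rewrite -sqrf_eq0 eq_le sqr_ge0 andbT -oppr_ge0.
by rewrite -Dr sqr_ge0.
Qed.

Lemma sqr_neq_odd_logn (p : nat) (d : int) (r : rat) :
  prime p -> odd (logn p `|d|) -> r ^+ 2 != d%:~R.
Proof.
move=> pr_p odd_d; apply/eqP => Dr; apply: (@odd_logn_msq p [::] d) => //.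
have [->|->] : sq d = ratr r \/ sq d = - ratr r.
- by apply: sqr_eq_sign; rewrite sqK -rmorphXn Dr /= ratr_int.
- by apply/CratP; exists r.
by apply/CratP; exists (- r); rewrite rmorphN.
Qed.

(** An irrational sqrt a is the square of a fourth root of [a], which settles every [a] with -a not
    a square. Otherwise [z] is a rational multiple of a square root of -1, written
    [sq (- 2) / sq 2], where 2 and -2 are both covered by the first case. *)
Lemma sqrt_Q_D4 (q : rat) (z : algC) : z ^+ 2 = ratr q -> Q_D4 z.
Proof.
have sf := compositum_subfield D4_field.
have QN x := @subfieldN Q_D4 x sf; have Qrat r := @subfield_rat Q_D4 r sf.
have D4sq (a : rat) (x : algC) : (forall r, r ^+ 2 != - a) -> x ^+ 2 = ratr a ->
    Q_D4 x.
  move=> nNa Dx; have [[r Dr]|na] := classic (exists r : rat, r ^+ 2 = a).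
    have [->|->] : x = ratr r \/ x = - ratr r.
    - by apply: sqr_eq_sign; rewrite Dx -rmorphXn Dr.
    - exact: Qrat.
    exact: QN (Qrat _).
  rewrite -[x]sqrtCK; apply: (subfieldX (K := Q_D4)) => //.
  apply: (fourth_root_Q_D4 (q := a)) => //; last by rewrite (exprM _ 2 2) sqrtCK.
  by move=> r; apply/eqP => Dr; apply: na; exists r.
move=> Dz; have [[r Dr]|nNq] := classic (exists r : rat, r ^+ 2 = - q); last first.
  by apply: (D4sq q) => // r; apply/eqP => Dr; apply: nNq; exists r.
have n2 (r' : rat) : r' ^+ 2 != 2%:~R by apply: (sqr_neq_odd_logn (p := 2)).
have D2 : Q_D4 (sq 2).
  apply: (D4sq 2%:~R); last by rewrite sqK ratr_int.
  by move=> r'; apply/eqP => Dr'; have := sqr_ge0 r'; rewrite Dr' oppr_ge0 lerz0.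
have DN2 : Q_D4 (sq (- 2)).
  by apply: (D4sq (- 2)%:~R); [rewrite rmorphN opprK | rewrite sqK ratr_int].
have [Di|Di] : z = ratr r * (sq (- 2) / sq 2) \/ z = - (ratr r * (sq (- 2) / sq 2)).
  apply: sqr_eq_sign; rewrite exprMn -rmorphXn Dr rmorphN Dz mulNr.
  have -> : (sq (- 2) / sq 2) ^+ 2 = -1.
    by rewrite expr_div_n !sqK rmorphN mulNr divff ?intr_eq0.
  by rewrite mulrN1 opprK.
  by rewrite Di; exact: (subfieldM sf (Qrat r) (subfield_div sf DN2 D2)).
by rewrite Di; exact: (QN _ (subfieldM sf (Qrat r) (subfield_div sf DN2 D2))).
Qed.

(** * Square roots of -1 and of the first primes *)

Lemma nat_prime_ind (P : nat -> Prop) :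
    P 1 -> (forall q m, prime q -> (0 < m)%N -> P m -> P (q * m)%N) ->
  forall m, (0 < m)%N -> P m.
Proof.
move=> P1 PM m; elim/ltn_ind: m => m IH m0; have [m1|m1] := leqP m 1.
  by rewrite (_ : m = 1%N) //; apply/eqP; rewrite eqn_leq m1.
have q_pr := pdiv_prime m1; have qm := pdiv_dvd m.
have d0 : (0 < m %/ pdiv m)%N by rewrite divn_gt0 ?pdiv_gt0 // pdiv_leq.
rewrite -(divnK qm) mulnC; apply: PM => //; apply: IH => //.
by rewrite ltn_Pdiv // prime_gt1.
Qed.

(** The largest prime comes first, so that for [n.+1] prime [sqrtQ n.+1] unfolds to
    [adjoin (sqrtQ n) (sq n.+1)], the tower on which the induction runs. The generator -1 takes care
    of signs, and [sqrtQ 0] is Q(i). *)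
Fixpoint gens (n : nat) : seq int :=
  if n is m.+1 then if prime n then n%:Z :: gens m else gens m else [:: -1].

Definition sqrtQ (n : nat) : algC -> Prop := msq (gens n).

Lemma sqrtQ_subfield n : is_subfield (sqrtQ n). Proof. exact: msq_subfield. Qed.
#[local] Hint Resolve sqrtQ_subfield : core.

Lemma mem_gens n d :
  d \in gens n <-> d = -1 \/ exists p : nat, [/\ prime p, (p <= n)%N & d = p%:Z].
Proof.
elim: n => [|n IH] /=.
  rewrite inE; split=> [/eqP|[->//|[p [pr_p]]]]; first by left.
  by rewrite leqn0 => /eqP p0; rewrite p0 in pr_p.
have IH' : d \in gens n <-> d = -1 \/
      exists p : nat, [/\ prime p, (p <= n.+1)%N, p <> n.+1 & d = p%:Z].
  rewrite IH; split=> -[|[p [pr_p le_p]]]; try by left.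
    by right; exists p; split=> //; lia.
  by move=> np Dd; right; exists p; split=> //; lia.
case: ifP => pr_n.
  rewrite inE; split=> [/predU1P[->|/IH'[|[p [*]]]]|[Dd|[p [pr_p le_p Dd]]]].
  - by right; exists n.+1.
  - by left.
  - by right; exists p.
  - by apply/orP; right; apply/IH'; left.
  have [Dp|np] := eqVneq p n.+1; first by rewrite Dd Dp eqxx.
  apply/orP; right; apply/IH'; right; exists p; split=> //; exact/eqP.
rewrite IH'; split=> -[|[p [pr_p le_p]]]; try by left.
  by move=> *; right; exists p.
move=> Dd; right; exists p; split=> // Dp; by rewrite Dp pr_n in pr_p.
Qed.

Lemma gens_coprime n d (q : nat) :
  d \in gens n -> prime q -> (q %| `|d|)%N -> (q <= n)%N.
Proof.
case/mem_gens=> [->|[p [pr_p le_p ->]]] pr_q /=.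
  by rewrite dvdn1 => /eqP q1; rewrite q1 in pr_q.
by rewrite dvdn_prime2 // => /eqP ->.
Qed.

Lemma gens_indep n : indep (gens n).
Proof.
elim: n => [|n IH] /=.
  split=> // /CratP[a Da]; have: a ^+ 2 = -1.
    by apply: (fmorph_inj (ratr : rat -> algC)); rewrite rmorphXn /= -Da sqK !rmorphN1.
  by move=> a2; have := sqr_ge0 a; rewrite a2 oppr_ge0 ler10.
case: ifP => // pr_n; split=> //; apply: (odd_logn_msq pr_n).
  by rewrite (logn_prime n.+1 pr_n) eqxx.
apply/allP => e gens_e; apply/negP => /(gens_coprime gens_e pr_n).
by rewrite ltnn.
Qed.

Lemma sqrtQ_gen n d : d \in gens n -> sqrtQ n (sq d).
Proof. exact: msq_gen. Qed.

Lemma sqrtQ_stable n (nu : aut) x : sqrtQ n x -> sqrtQ n (nu x).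
Proof. exact: msq_stable. Qed.

Lemma sqrtQ_mono m n x : (m <= n)%N -> sqrtQ m x -> sqrtQ n x.
Proof.
move=> le_mn; apply: msq_min => // d /mem_gens gens_d; apply: sqrtQ_gen.
apply/mem_gens; case: gens_d => [|[p [pr_p le_p Dd]]]; first by left.
by right; exists p; split=> //; apply: leq_trans le_mn.
Qed.

Lemma sqrtQ_sqM n (d e : int) : sqrtQ n (sq d) -> sqrtQ n (sq e) -> sqrtQ n (sq (d * e)).
Proof.
move=> Bd Be; have Bde : sqrtQ n (sq d * sq e) by apply: subfieldM.
by have [->|->] := sqM_sign d e => //; apply: subfieldN.
Qed.

Definition smooth (n : nat) (d : int) : Prop :=
  d <> 0 /\ forall q, prime q -> (q %| `|d|)%N -> (q <= n)%N.

Lemma sqrtQ_smooth n d : smooth n d -> sqrtQ n (sq d).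
Proof.
case=> d0 sm_d.
have Bn (m : nat) : (0 < m)%N -> (forall q, prime q -> (q %| m)%N -> (q <= n)%N) ->
    sqrtQ n (sq m).
  move: m; apply: nat_prime_ind => [_|q m pr_q m0 IH sm_qm].
    by rewrite /sq sqrtC1; apply: subfield1.
  rewrite PoszM; apply: sqrtQ_sqM.
    apply: sqrtQ_gen; apply/mem_gens; right; exists q; split=> //.
    by apply: sm_qm => //; apply: dvdn_mulr.
  by apply: IH => r pr_r rm; apply: sm_qm => //; apply: dvdn_mull.
have {}Bn : sqrtQ n (sq `|d|%N).
  by apply: Bn => //; rewrite absz_gt0; apply/eqP.
have [d1|d1] := leP 0 d; first by rewrite -(gez0_abs d1).
rewrite -[d]opprK -(ltz0_abs d1) -mulN1r; apply: sqrtQ_sqM => //.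
by apply: sqrtQ_gen; apply/mem_gens; left.
Qed.

Lemma lt_smooth n (d : int) : d <> 0 -> (`|d| <= n)%N -> smooth n d.
Proof.
move=> d0 le_dn; split=> // q _ /dvdn_leq qd; apply: leq_trans le_dn.
by apply: qd; rewrite absz_gt0; apply/eqP.
Qed.

Lemma smoothM n d e : smooth n d -> smooth n e -> smooth n (d * e).
Proof.
case=> d0 sm_d [e0 sm_e]; split.
  by apply/eqP; rewrite mulf_neq0 //; apply/eqP.
by move=> q pr_q; rewrite abszM Euclid_dvdM // => /orP[/sm_d|/sm_e]; apply.
Qed.

(** Kummer theory for a multiquadratic field. Adding to [chi] the character of [sq d] when
    [chi flip] holds makes it trivial on [flip], so that it depends only on the remaining square
    roots; [c] is multiplied by [d] accordingly. *)
Lemma kummer_character ds (chi : aut -> bool) :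
    indep ds ->
    (forall s t : aut, chi (s \o t : aut) = chi s (+) chi t) ->
    (forall s : aut, {in ds, forall d, s (sq d) = sq d} -> chi s = false) ->
  exists c : int, [/\ c <> 0,
    forall q, prime q -> (q %| `|c|)%N -> exists2 d, d \in ds & (q %| `|d|)%N
    & forall s : aut, s (sq c) = (-1) ^+ chi s * sq c].
Proof.
elim: ds chi => [|d ds IH] chi /= ind chiM chi1.
  exists 1; split=> // [q pr_q|s]; first by rewrite dvdn1 => /eqP q1; rewrite q1 in pr_q.
  by rewrite chi1 // expr0 mul1r /sq rmorph1 sqrtC1 rmorph1.
case: ind => nd ind; have [flip [fixf Df]] := msq_flip nd.
have d0 : sq d != 0.
  by apply: contra_notN nd => /eqP->; apply: (subfield_nat 0).
pose chid (s : aut) := s (sq d) != sq d.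
have nsq : - sq d != sq d by rewrite eq_sym -addr_eq0 -mulr2n mulrn_eq0.
have Dchid (s : aut) : s (sq d) = (-1) ^+ chid s * sq d.
  rewrite /chid; have [->|->] := aut_sq s (sqK d); rewrite ?eqxx ?nsq ?mul1r //.
  by rewrite expr1 mulN1r.
have chidM (s t : aut) : chid (s \o t : aut) = chid s (+) chid t.
  rewrite /chid /=; have [->|Dt] := aut_sq t (sqK d); first by rewrite eqxx addbF.
  rewrite Dt rmorphN /= nsq; have [->|->] := aut_sq s (sqK d).
    by rewrite nsq eqxx.
  by rewrite opprK eqxx nsq.
pose chi' s := chi s (+) (chi flip && chid s).
have [s t||c [c0 sm_c Dc]] := IH chi' ind.
- by rewrite /chi' chiM chidM andb_addr addbACA.
- move=> s fixs; rewrite /chi'.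
  have chidf : chid flip by rewrite /chid Df.
  have [sd|sd] := boolP (chid s); last first.
    rewrite andbF addbF; apply: chi1 => e; rewrite inE => /predU1P[->|/fixs//].
    by apply/eqP; rewrite -[_ == _]negbK.
  have: chi (s \o flip : aut) = false.
    apply: chi1 => e; rewrite inE => /predU1P[->|dse] /=.
      by rewrite Df rmorphN Dchid sd expr1 mulN1r opprK.
    by rewrite fixf ?fixs //; apply: msq_gen.
  by rewrite chiM andbT.
have dZ : d <> 0 by move=> dZ; move: d0; rewrite /sq dZ sqrtC0 eqxx.
rewrite /chi' in Dc; case Dcf: (chi flip) Dc => /= Dc; last first.
  exists c; split=> // [q pr_q /sm_c[]// e dse qe|s].
    by exists e => //; rewrite inE dse orbT.
  by rewrite Dc addbF.
exists (c * d); split=> [|q pr_q|s].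
- by apply/eqP; rewrite mulf_neq0 //; apply/eqP.
- rewrite abszM Euclid_dvdM // => /orP[/sm_c[]// e dse qe|qd].
    by exists e => //; rewrite inE dse orbT.
  by exists d => //; rewrite mem_head.
have Ds : s (sq c * sq d) = (-1) ^+ chi s * (sq c * sq d).
  rewrite rmorphM Dc Dchid mulrACA -signr_addb -addbA addbb addbF //.
have [->|->] := sqM_sign c d; first exact: Ds.
by rewrite rmorphN /= Ds mulrN.
Qed.

(** * Norms at a prime *)

Lemma intr_Fp_eq0 (p : nat) (c : int) :
  prime p -> (c%:~R == 0 :> 'F_p) = (p %| `|c|)%N.
Proof.
move=> pr_p; have pE n : (n%:R == 0 :> 'F_p) = (p %| n)%N.
  by rewrite (dvdn_pcharf (pchar_Fp pr_p)).
by case: c => n; rewrite ?NegzE ?rmorphN /= ?oppr_eq0 pE.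
Qed.

Lemma intr_Zp_eq0 (q : nat) (c : int) :
  (1 < q)%N -> (c%:~R == 0 :> 'Z_q) = (q %| `|c|)%N.
Proof.
move=> q1; have qE n : (n%:R == 0 :> 'Z_q) = (q %| n)%N.
  by rewrite -val_eqE /= val_Zp_nat.
by case: c => n; rewrite ?NegzE ?rmorphN /= ?oppr_eq0 qE.
Qed.

(* Euler's criterion for [c] to be a square modulo the odd prime [p]. *)
Definition leg (p : nat) (c : int) : bool := (c%:~R : 'F_p) ^+ p.-1./2 == 1.

Section Legendre.

Variable p : nat.
Hypotheses (pr_p : prime p) (odd_p : odd p).

Let m := p.-1./2.
Let p_m : p.-1 = (m * 2)%N.
Proof. by rewrite muln2 even_halfK //; case: p odd_p. Qed.

Lemma leg_sign (c : int) :
  ~~ (p %| `|c|)%N -> (c%:~R : 'F_p) ^+ m = (-1) ^+ ~~ leg p c.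
Proof.
rewrite -(intr_Fp_eq0 c pr_p) => c0; rewrite /leg -/m.
have: ((c%:~R : 'F_p) ^+ m) ^+ 2 == 1 ^+ 2.
  rewrite -exprM -p_m expr1n; apply/eqP/(mulfI c0).
  by rewrite -exprS prednK ?prime_gt0 // mulr1 -[RHS]expf_card card_Fp.
rewrite eqf_sqr => /orP[] /eqP Dc; first by rewrite Dc eqxx.
by case: eqP Dc => [-> _ //|_ ->]; rewrite expr1.
Qed.

Lemma legM (c d : int) : ~~ (p %| `|c|)%N -> ~~ (p %| `|d|)%N ->
  ~~ leg p (c * d) = ~~ leg p c (+) ~~ leg p d.
Proof.
move=> pc pd; have pcd : ~~ (p %| `|(c * d)%R|)%N.
  by rewrite abszM Euclid_dvdM // negb_or pc.
have := leg_sign pcd; rewrite rmorphM exprMn !leg_sign // -signr_addb.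
have nopp : (1 : 'F_p) != -1.
  have odd2 : ~~ (p %| 2)%N.
    by rewrite dvdn_prime2 //; apply: contraTneq odd_p => ->.
  by rewrite -addr_eq0 (_ : 1 + 1 = 2%:~R) // intr_Fp_eq0.
case: (_ (+) _); case: (~~ leg p _) => // /eqP;
  by rewrite expr0 expr1 ?(eq_sym (-1)) (negPf nopp).
Qed.

(** The unit group of F_p is cyclic of order 2m: if the m-th power of g^k is 1 for a generator g,
    then k is even. *)
Lemma legP (c : int) : ~~ (p %| `|c|)%N -> leg p c ->
  exists2 u : nat, (0 < u < p)%N & (p %| `|((u%:Z) ^+ 2 - c)%R|)%N.
Proof.
move=> pc lc; have c0 : (c%:~R : 'F_p) != 0 by rewrite intr_Fp_eq0.
have [x Dx] : exists x : 'F_p, x ^+ 2 = c%:~R.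
  have Uc : (c%:~R : 'F_p) \is a GRing.unit by rewrite unitfE.
  pose y := FinRing.unit 'F_p Uc.
  have /cyclicP[g genG] := field_unit_group_cyclic [set: {unit 'F_p}]%G.
  have og : #[g]%g = (m * 2)%N.
    by rewrite orderE -genG /= card_finField_unit card_Fp // p_m.
  have /cycleP[k Dy] : y \in <[g]>%g by rewrite -genG inE.
  have: (#[g]%g %| k * m)%N.
    rewrite order_dvdn expgM -Dy; apply/eqP/val_inj.
    by rewrite FinRing.val_unitX FinRing.val_unit1; apply/eqP.
  have m0 : (0 < m)%N.
    by rewrite -(ltn_pmul2r (m := 2)) // -p_m mul0n -subn1 subn_gt0 prime_gt1.
  rewrite og mulnC dvdn_pmul2r // => /dvdnP[j Dk]; exists (val (g ^+ j)%g).
  have -> : c%:~R = val y by [].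
  by rewrite Dy Dk expgM !FinRing.val_unitX.
have x0 : x != 0 by apply: contraNneq c0 => x0; rewrite -Dx x0 expr0n.
exists (val x).
  rewrite lt0n -val_eqE /= in x0 *.
  by rewrite x0 -[X in (_ < X)%N](Fp_cast pr_p) ltn_ord.
have Dvx : (val x)%:Z%:~R = x by exact: natr_Zp.
by rewrite -intr_Fp_eq0 // rmorphB rmorphXn /= Dvx Dx subrr.
Qed.

Lemma hensel_sqrt (d : int) k : ~~ (p %| `|d|)%N -> leg p d ->
  exists u : int, ((p ^ k.+1)%:Z %| (u ^+ 2 - d))%Z.
Proof.
move=> pd ld; elim: k => [|k [u /dvdzP[t Du]]].
  by have [u _ Du] := legP pd ld; exists u; rewrite expn1 /dvdz /=.
have pu : coprimez p (2 * u).
  rewrite coprimezE abszM coprimeMr /= coprimen2 odd_p.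
  rewrite prime_coprime //; apply/negP => pu; case/negP: pd.
  have: (p%:Z %| u ^+ 2 - (u ^+ 2 - d))%Z.
    rewrite rpredB //; first by rewrite dvdz_exp.
    by rewrite Du dvdz_mull // expnS PoszM dvdz_mulr.
  by rewrite opprB addrC subrK.
have /coprimezP[[a b] /= Dab] := pu.
(* Newton's step: [b] inverts [2 * u] modulo [p], so this correction cancels the error
   [t * p ^ k.+1] modulo [p ^ k.+2]. *)
exists (u - (p ^ k.+1)%:Z * t * b).
apply/dvdzP; exists (t * a + (p ^ k)%:Z * t ^+ 2 * b ^+ 2).
have Pk : (p ^ k.+2)%:Z = (p ^ k.+1)%:Z * p%:Z by rewrite -PoszM -expnSr.
have Pk1 : (p ^ k.+1)%:Z = (p ^ k)%:Z * p%:Z by rewrite -PoszM -expnSr.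
transitivity ((u ^+ 2 - d) - 2 * u * ((p ^ k.+1)%:Z * t * b)
   + ((p ^ k.+1)%:Z * t * b) ^+ 2).
  by ring.
rewrite Du Pk.
transitivity (t * (p ^ k.+1)%:Z * (a * p%:Z + b * (2 * u))
   - 2 * u * ((p ^ k.+1)%:Z * t * b) + ((p ^ k.+1)%:Z * t * b) ^+ 2).
  by rewrite Dab mulr1.
by rewrite Pk1; ring.
Qed.

(* A solution of [p (a^2 - c b^2) = e m^2] modulo a high power of [p] forces
   [m] to be highly divisible by [p]: infinite descent. *)
Lemma norm_descent (c e : int) k (a b m1 : int) :
    ~~ (p %| `|c|)%N -> ~~ leg p c -> `|e|%N = 1%N ->
    ((p ^ (k * 2))%:Z %| p%:Z * (a ^+ 2 - c * b ^+ 2) - e * m1 ^+ 2)%Z ->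
  ((p ^ k)%:Z %| m1)%Z.
Proof.
move=> pc lc e1; elim: k a b m1 => [|k IH] a b m1; first by rewrite dvd1z.
have p0 : p%:Z != 0 by rewrite eqz_nat -lt0n prime_gt0.
rewrite mulSn expnD PoszM -[(p ^ 2)%N]mulnn PoszM => dv.
have sqp (x : int) : (p%:Z %| x ^+ 2)%Z -> (p%:Z %| x)%Z.
  by rewrite !dvdzE abszX /= Euclid_dvdX // andbT.
have pm : (p%:Z %| m1)%Z.
  apply: sqp; rewrite -(Gauss_dvdzr (n := e)); last by rewrite coprimezE e1 /= coprimen1.
  have: (p%:Z %| p%:Z * (a ^+ 2 - c * b ^+ 2) - e * m1 ^+ 2)%Z.
    by apply: dvdz_trans dv; rewrite -mulrA dvdz_mulr.
  by rewrite rpredBl // dvdz_mulr.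
case/dvdzP: pm dv => m2 -> dv.
have pN : (p%:Z %| a ^+ 2 - c * b ^+ 2)%Z.
  have: (p%:Z * p%:Z %| p%:Z * (a ^+ 2 - c * b ^+ 2) - e * (m2 * p) ^+ 2)%Z.
    by apply: dvdz_trans dv; rewrite dvdz_mulr.
  rewrite rpredBr; first by rewrite dvdz_mul2l.
  by rewrite (_ : e * _ ^+ 2 = (e * m2 ^+ 2) * (p%:Z * p)); [rewrite dvdz_mull | ring].
(* Otherwise [c] would be the square of a/b modulo [p], although it is a nonresidue. *)
have pb : (p%:Z %| b)%Z.
  apply: NNPP => npb; case/negP: lc.
  have npb' : (b%:~R : 'F_p) != 0 by rewrite intr_Fp_eq0 //; apply/negP.
  have Dc : c%:~R = (a%:~R / b%:~R) ^+ 2 :> 'F_p.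
    have: ((a ^+ 2 - c * b ^+ 2)%:~R : 'F_p) == 0 by rewrite intr_Fp_eq0.
    rewrite rmorphB rmorphXn rmorphM rmorphXn subr_eq0 /= => /eqP Da.
    by rewrite expr_div_n Da mulfK // expf_neq0.
  rewrite /leg Dc -exprM mulnC -p_m; apply/eqP.
  have x0 : (a%:~R / b%:~R : 'F_p) != 0.
    apply: contraNneq pc => x0; move: Dc; rewrite x0 expr0n /=.
    by move/eqP; rewrite intr_Fp_eq0.
  apply: (mulfI x0); rewrite -exprS prednK ?prime_gt0 // mulr1.
  by rewrite -[RHS]expf_card card_Fp.
have pa : (p%:Z %| a)%Z.
  apply: sqp; move: pN; rewrite rpredBr //.
  by rewrite dvdz_mull // expr2 dvdz_mull.
case/dvdzP: pa pb dv {pN} => a2 -> /dvdzP[b2 ->].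
rewrite (_ : _ - _ = p%:Z * p * (p%:Z * (a2 ^+ 2 - c * b2 ^+ 2) - e * m2 ^+ 2)).
  rewrite dvdz_mul2l ?mulf_neq0 // => /IH pkm.
  by rewrite expnSr PoszM dvdz_mul.
by ring.
Qed.

End Legendre.

(** * Reduction of multiquadratic integers modulo prime powers *)

Definition msqZ (ds : seq int) : algC -> Prop :=
  foldr (fun d O => adjoin O (sq d)) (fun x => exists m : int, x = m%:~R) ds.

Lemma msqZ_mulz ds x (m : int) : msqZ ds x -> msqZ ds (m%:~R * x).
Proof.
elim: ds x => [|d ds IH] x /=; first by case=> k ->; exists (m * k); rewrite rmorphM.
case=> a [b [Oa Ob ->]]; exists (m%:~R * a), (m%:~R * b).
by split; [apply: IH | apply: IH | ring].
Qed.

(** Only integral combinations of the square roots can be reduced modulo a power of [p], so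
    denominators are cleared before [msq_rel] is applied. *)
Lemma msqZ_denom ds x : msq ds x -> exists2 m : int, m != 0 & msqZ ds (m%:~R * x).
Proof.
elim: ds x => [|d ds IH] x /=.
  case/CratP=> a ->; exists (denq a); rewrite ?denq_neq0 //; exists (numq a).
  by rewrite /ratr mulrC divfK // intr_eq0 denq_neq0.
case=> a [b [/IH[m m0 Oa] /IH[k k0 Ob] ->]]; exists (m * k).
  by rewrite mulf_neq0.
exists (k%:~R * (m%:~R * a)), (m%:~R * (k%:~R * b)).
by split; [apply: msqZ_mulz | apply: msqZ_mulz | rewrite rmorphM; ring].
Qed.

(* Graph of the ring morphism from [msqZ ds] to [A] sending [sq d] to [rt d];
   it is functional when the [d]s are independent. *)
Fixpoint msq_rel (A : comNzRingType) (rt : int -> A) (ds : seq int) (x : algC) (z : A) :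
    Prop :=
  if ds is d :: ds' then
    exists a b u v, [/\ msq_rel rt ds' a u, msq_rel rt ds' b v,
      x = a + b * sq d & z = u + v * rt d]
  else exists m : int, x = m%:~R /\ z = m%:~R.

Section MsqRel.

Variables (A : comNzRingType) (rt : int -> A).
Local Notation rel := (msq_rel rt).

Lemma msq_rel_int ds (m : int) : rel ds m%:~R m%:~R.
Proof.
elim: ds m => [|d ds IH] m /=; first by exists m.
exists m%:~R, 0%:~R, m%:~R, 0%:~R; split=> //; rewrite mulr0z; ring.
Qed.

Lemma msq_relD ds x y u v : rel ds x u -> rel ds y v -> rel ds (x + y) (u + v).
Proof.
elim: ds x y u v => [|d ds IH] x y u v /=.
  by case=> m [-> ->] [k [-> ->]]; exists (m + k); rewrite !rmorphD.
case=> a [b [u1 [u2 [Ra Rb -> ->]]]] [c [e [v1 [v2 [Rc Re -> ->]]]]].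
exists (a + c), (b + e), (u1 + v1), (u2 + v2).
by split; [apply: IH | apply: IH | ring | ring].
Qed.

Lemma msq_relM ds x y u v : {in ds, forall d, rt d ^+ 2 = d%:~R} ->
  rel ds x u -> rel ds y v -> rel ds (x * y) (u * v).
Proof.
elim: ds x y u v => [|d ds IH] x y u v rtK /=.
  by case=> m [-> ->] [k [-> ->]]; exists (m * k); rewrite !rmorphM.
have {}IH x' y' u' v' : rel ds x' u' -> rel ds y' v' -> rel ds (x' * y') (u' * v').
  by apply: IH => e dse; apply: rtK; rewrite inE dse orbT.
case=> a [b [u1 [u2 [Ra Rb -> ->]]]] [c [e [v1 [v2 [Rc Re -> ->]]]]].
exists (a * c + b * e * d%:~R), (a * e + b * c).
exists (u1 * v1 + u2 * v2 * d%:~R), (u1 * v2 + u2 * v1); split.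
- apply: msq_relD; first exact: IH.
  by apply: (IH _ _ _ _ (IH _ _ _ _ _ _)) => //; apply: msq_rel_int.
- by apply: msq_relD; apply: IH.
- by rewrite -sqK; ring.
by rewrite -(rtK d) ?mem_head //; ring.
Qed.

Lemma msq_rel_msq ds x u : rel ds x u -> msq ds x.
Proof.
elim: ds x u => [|d ds IH] x u /=; first by case=> m [-> _]; apply/rpred_int.
by case=> a [b [u1 [u2 [/IH dsa /IH dsb -> _]]]]; exists a, b.
Qed.

Lemma msq_rel0 ds u : indep ds -> rel ds 0 u -> u = 0.
Proof.
elim: ds u => [|d ds IH] u /=.
  by move=> _ [m [/esym/eqP]]; rewrite intr_eq0 => /eqP -> ->.
case=> nd ind [a [b [u1 [u2 [Ra Rb /esym Dab ->]]]]].
have [a0 b0] := adjoin_uniq (msq_subfield ds) nd (msq_rel_msq Ra) (msq_rel_msq Rb) Dab.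
rewrite a0 in Ra; rewrite b0 in Rb.
by rewrite (IH _ ind Ra) (IH _ ind Rb) mul0r addr0.
Qed.

Lemma msq_rel_total ds x : msqZ ds x -> exists u, rel ds x u.
Proof.
elim: ds x => [|d ds IH] x /=; first by case=> m ->; exists m%:~R, m.
case=> a [b [/IH[u Ra] /IH[v Rb] ->]].
by exists (u + v * rt d), a, b, u, v.
Qed.

End MsqRel.

(** Needed because the residues used in [frobenius_norm] may be dependent (when [c] is a generator,
    [c * c] occurs among them), while [msq_rel] is functional only on independent lists. *)
Lemma indep_sub ds : exists ds',
  [/\ indep ds', {subset ds' <= ds} & forall x, msq ds x -> msq ds' x].
Proof.
elim: ds => [|d ds [ds' [ind sds sK]]]; first by exists [::].
have [Kd | nKd] := classic (msq ds' (sq d)).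
  exists ds'; split=> // [e dse|x]; first by rewrite inE sds ?orbT.
  exact: adjoin_sub.
exists (d :: ds'); split=> // [e|x [a [b [Ka Kb ->]]]].
  by rewrite !inE => /orP[->//|/sds->]; rewrite orbT.
by exists a, b; split=> //; apply: sK.
Qed.

(* A multiquadratic field generated by square roots of quadratic residues
   embeds in the p-adic numbers, where [x^2 - c y^2] has even valuation. *)
Lemma residue_norm (p : nat) ds (c : int) (e : int) x y :
    prime p -> odd p -> {in ds, forall d : int, ~~ (p %| `|d|)%N /\ leg p d} ->
    ~~ (p %| `|c|)%N -> ~~ leg p c -> `|e|%N = 1%N -> msq ds x -> msq ds y ->
  p%:R * (x ^+ 2 - c%:~R * y ^+ 2) <> e%:~R.
Proof.
move=> pr_p odd_p res_ds pc lc e1 dsx dsy Dxy.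
have [ds' [ind sds sK]] := indep_sub ds.
have [m m0 Ox] := msqZ_denom (sK _ dsx); have [k k0 Oy] := msqZ_denom (sK _ dsy).
have {}Ox : msqZ ds' (k%:~R * (m%:~R * x)) by apply: msqZ_mulz.
have {}Oy : msqZ ds' (m%:~R * (k%:~R * y)) by apply: msqZ_mulz.
(* The common denominator [m * k] turns out to be divisible by every power of [p], although it is
   nonzero. *)
have mk_div n : ((p ^ n)%:Z %| m * k)%Z.
  case: n => [|n]; first by rewrite dvd1z.
  (* The exponent is doubled because [norm_descent] extracts only half of it. *)
  pose q := (p ^ (n.+1 * 2))%N.
  have q1 : (1 < q)%N.
    by rewrite -(exp1n (n.+1 * 2)) ltn_exp2r // prime_gt1.
  pose rt (d : int) : 'Z_q := odflt 0 [pick r | r ^+ 2 == d%:~R].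
  have rtK : {in ds', forall d, rt d ^+ 2 = d%:~R}.
    move=> d /sds/res_ds[pd ld]; rewrite /rt; case: pickP => [r /eqP//|nor].
    have [u /dvdzP[t Du]] := @hensel_sqrt p pr_p odd_p d (n.+1 * 2).-1 pd ld.
    have /negP[] := negbT (nor u%:~R); rewrite -rmorphXn -subr_eq0 -rmorphB.
    by rewrite intr_Zp_eq0 // Du abszM dvdn_mull.
  have [a Ra] := msq_rel_total rt Ox; have [b Rb] := msq_rel_total rt Oy.
  have Rint := msq_rel_int rt ds'.
  have := msq_relM rtK (Rint p%:Z) (msq_relD (msq_relM rtK Ra Ra)
     (msq_relM rtK (Rint (- c)) (msq_relM rtK Rb Rb))).
  move/msq_relD => /(_ _ _ (Rint (- (e * (m * k) ^+ 2)))).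
  set z := (X in msq_rel _ _ X _); set w := (X in msq_rel _ _ _ X) => Rzw.
  have z0 : z = 0.
    rewrite /z !rmorphN rmorphM rmorphXn rmorphM /= -Dxy.
    rewrite -[(p : int)%:~R]/(p%:R); ring.
  rewrite z0 in Rzw; have w0 := msq_rel0 ind Rzw.
  apply: (@norm_descent p pr_p odd_p c e n.+1 (a : nat) (b : nat)) => //.
  rewrite dvdzE /= -/q -intr_Zp_eq0 //; apply/eqP; rewrite -[RHS]w0 /w.
  have Da : (a : nat)%:~R = a by exact: natr_Zp.
  have Db : (b : nat)%:~R = b by exact: natr_Zp.
  rewrite !rmorphN rmorphB; congr (_ + _).
  rewrite rmorphM rmorphB rmorphXn rmorphM rmorphXn /= Da Db; ring.
have mk0 : (0 < `|(m * k)%R|)%N by rewrite absz_gt0 mulf_neq0.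
have := dvdn_leq mk0 (mk_div `|(m * k)%R|%N); apply/negP; rewrite -ltnNge.
by rewrite ltn_expl ?prime_gt1.
Qed.

(** The sign of [phi] on [sq d] and the residue symbol of [d] are both multiplicative in [d], so
    agreement on -1 and the primes up to [n] suffices. *)
Lemma leg_aut n (phi : aut) d :
    prime n.+1 -> odd n.+1 ->
    {in gens n, forall l, phi (sq l) = (-1) ^+ (~~ leg n.+1 l) * sq l} ->
    smooth n d ->
  phi (sq d) = (-1) ^+ (~~ leg n.+1 d) * sq d.
Proof.
move=> pr_p odd_p Dphi; set p := n.+1 in pr_p odd_p Dphi *.
have sm_p e : smooth n e -> ~~ (p %| `|e|)%N.
  by case=> _ sm_e; apply/negP => /(sm_e _ pr_p); rewrite ltnn.
have phiM d1 d2 : smooth n d1 -> smooth n d2 ->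
    phi (sq d1) = (-1) ^+ (~~ leg p d1) * sq d1 ->
    phi (sq d2) = (-1) ^+ (~~ leg p d2) * sq d2 ->
    phi (sq (d1 * d2)) = (-1) ^+ (~~ leg p (d1 * d2)) * sq (d1 * d2).
  move=> sm1 sm2 D1 D2; rewrite legM ?sm_p // signr_addb.
  have D12 : phi (sq d1 * sq d2) =
      (-1) ^+ (~~ leg p d1) * (-1) ^+ (~~ leg p d2) * (sq d1 * sq d2).
    by rewrite rmorphM /= D1 D2; ring.
  by have [->|->] := sqM_sign d1 d2; rewrite ?rmorphN /= D12 ?mulrN.
have smooth1 : smooth n (-1).
  by split=> // q pr_q; rewrite dvdn1 => /eqP q1; rewrite q1 in pr_q.
have D_1 : phi (sq (-1)) = (-1) ^+ (~~ leg p (-1)) * sq (-1).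
  by apply: Dphi; apply/mem_gens; left.
have Dnat (m : nat) : (0 < m)%N -> smooth n m ->
    phi (sq m) = (-1) ^+ (~~ leg p m) * sq m.
  move: m; apply: nat_prime_ind => [_|q m pr_q m0 IH sm_qm].
    by rewrite /sq sqrtC1 rmorph1 /leg expr1n eqxx mul1r.
  have sm_m : smooth n m.
    split; first by case: m m0 {IH sm_qm}.
    by move=> r pr_r rm; apply: sm_qm.2 => //; rewrite /= dvdn_mull.
  have le_qn : (q <= n)%N by apply: sm_qm.2 => //; rewrite /= dvdn_mulr.
  rewrite PoszM; apply: phiM => //; last exact: IH.
    by apply: lt_smooth => //; case: q pr_q {le_qn sm_qm}.
  by apply: Dphi; apply/mem_gens; right; exists q.
case=> d0 sm_d; have ad0 : (0 < `|d|)%N by rewrite absz_gt0; apply/eqP.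
have sm_ad : smooth n `|d|%N by split=> //; case: `|d|%N ad0.
have [d1|d1] := leP 0 d; first by rewrite -(gez0_abs d1); apply: Dnat.
have := phiM (-1) `|d|%N smooth1 sm_ad D_1 (Dnat _ ad0 sm_ad).
by rewrite mulN1r ltz0_abs // opprK.
Qed.

(* [phi] is a Frobenius at [p = n.+1] on the field [sqrtQ n], unramified at [p]. *)
Lemma frobenius_norm n (c : int) :
    prime n.+1 -> odd n.+1 -> smooth n c -> ~~ leg n.+1 c ->
  exists phi : aut, phi (sq c) = - sq c /\
    forall v, sqrtQ n v -> (n.+1%:R * (v * phi v)) ^+ 2 <> 1.
Proof.
move=> pr_p odd_p sm_c lc; set p := n.+1 in pr_p odd_p lc *.
have [phi Dphi] := indep_aut (fun l => ~~ leg p l) (gens_indep n).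
have phic := leg_aut pr_p odd_p Dphi sm_c; rewrite -/p lc mulN1r in phic.
exists phi; split=> // v Bv Nv.
have sm_p e : smooth n e -> ~~ (p %| `|e|)%N.
  by case=> _ sm_e; apply/negP => /(sm_e _ pr_p); rewrite ltnn.
have sm_gen l : l \in gens n -> smooth n l.
  move=> gl; split; last by move=> q; apply: gens_coprime.
  by move: gl => /mem_gens[->//|[q [pr_q _ ->]]]; case: q pr_q.
(* Multiplying each nonresidue generator by the nonresidue [c] gives residues, whose square roots
   [phi] fixes. Over the field they generate, [v] becomes [x + y * sq c], and [v * phi v] becomes
   the norm form treated by [residue_norm]. *)
pose ds := [seq (if leg p l then l else l * c) | l <- gens n].
have sqc0 : sq c != 0.
  by rewrite /sq sqrtC_eq0 intr_eq0; apply/eqP; case: sm_c.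
have Kds : is_subfield (adjoin (msq ds) (sq c)).
  by apply: adjoin_subfield => //; rewrite sqK; apply: subfield_int.
have [x [y [dsx dsy Dv]]] : adjoin (msq ds) (sq c) v.
  apply: msq_min Bv => // l gl.
  have dsl : (if leg p l then l else l * c) \in ds by apply: map_f.
  case: ifP dsl => [_ dsl|_ dsl].
    by apply: adjoin_base => //; apply: msq_gen.
  have Kl : adjoin (msq ds) (sq c) (sq (l * c) / sq c).
    apply: (subfield_div Kds); last exact: adjoin_gen.
    by apply: adjoin_base => //; apply: msq_gen.
  have [El|El] := sqM_sign l c; rewrite El ?mulNr mulfK // in Kl.
  by rewrite -[sq l]opprK; apply: subfieldN.
have res_ds : {in ds, forall d : int, ~~ (p %| `|d|)%N /\ leg p d}.
  move=> _ /mapP[l /sm_gen sm_l ->]; case: ifP => ll; first by rewrite sm_p.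
  rewrite sm_p; last exact: smoothM.
  split=> //; rewrite -[leg p _]negbK legM ?sm_p //.
  by rewrite ll lc.
have phids z : msq ds z -> phi z = z.
  apply: msq_fix => d dsd; have [_ ld] := res_ds _ dsd.
  rewrite (leg_aut pr_p odd_p Dphi) ?ld ?mul1r //.
  case/mapP: dsd => l /sm_gen sm_l ->; case: ifP => // _; exact: smoothM.
have {}Nv : (p%:R * (x ^+ 2 - c%:~R * y ^+ 2)) ^+ 2 = 1.
  rewrite -[RHS]Nv -/p Dv rmorphD rmorphM /= (phids x dsx) (phids y dsy).
  by rewrite phic -sqK; ring.
have [N1|N1] : p%:R * (x ^+ 2 - c%:~R * y ^+ 2) = 1
            \/ p%:R * (x ^+ 2 - c%:~R * y ^+ 2) = -1.
- by apply: sqr_eq_sign; rewrite expr1n.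
- exact: (residue_norm (e := 1) pr_p odd_p res_ds (sm_p _ sm_c) lc _ dsx dsy N1).
apply: (residue_norm (e := -1) pr_p odd_p res_ds (sm_p _ sm_c) lc _ dsx dsy) => //.
Qed.

(** * Tate's reduction *)

Lemma Q_D4_subfield : is_subfield Q_D4.
Proof. exact: compositum_subfield. Qed.

(* Up to a factor in [sqrtQ n], the elements [theta] such that [sqrtQ n] adjoined
   [theta] is a Galois extension of Q, central of degree at most 2 over [sqrtQ n]. *)
Definition central_sqrt (n : nat) (theta : algC) : Prop :=
  [/\ theta != 0, sqrtQ n (theta ^+ 2) & forall s : aut, sqrtQ n (s theta / theta)].

Lemma central_sqrt_base n x : x != 0 -> sqrtQ n x -> central_sqrt n x.
Proof.
move=> x0 Bx; split=> // [|s]; first exact: subfieldX.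
by apply: subfield_div => //; apply: sqrtQ_stable.
Qed.

Lemma central_sqrtM n x y : central_sqrt n x -> central_sqrt n y -> central_sqrt n (x * y).
Proof.
case=> x0 Bx Tx [y0 By Ty]; split=> [||s]; first exact: mulf_neq0.
  by rewrite exprMn; apply: subfieldM.
rewrite rmorphM (_ : _ / _ = (s x / x) * (s y / y)); first exact: subfieldM.
by rewrite mulf_div.
Qed.

Lemma sqrtQ_Q_D4 n x : sqrtQ n x -> Q_D4 x.
Proof.
apply: (msq_min Q_D4_subfield) => d _.
by apply: (sqrt_Q_D4 (q := d%:~R)); rewrite sqK ratr_int.
Qed.

(** With t = tau theta / theta, the involution gives tau t * t = 1, and Hilbert 90 has the explicit
    solution s = 1 + t. It vanishes only for t = -1, where the anti-invariant [e] serves instead. *)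
Lemma hilbert90_involution (K : algC -> Prop) (tau : aut) (theta e : algC) :
    is_subfield K -> theta != 0 -> K (tau theta / theta) ->
    tau (tau theta) = theta -> K e -> e != 0 -> tau e = - e ->
  exists s, [/\ K s, s != 0 & tau (theta * s) = theta * s].
Proof.
move=> sfK th0; set t := tau theta / theta => Kt tt Ke e0 te.
have Dt : tau theta = t * theta by rewrite divfK.
have t0 : t != 0 by rewrite mulf_neq0 ?invr_eq0 ?fmorph_eq0.
have Nt : tau t * t = 1.
  by apply: (mulIf th0); rewrite mul1r -mulrA -Dt -rmorphM -Dt.
have [t1 | t1] := eqVneq t (-1).
  by exists e; split=> //; rewrite rmorphM /= te Dt t1; ring.
exists (1 + t); split; first by apply: subfieldD => //; apply: subfield1.
  by rewrite addrC addr_eq0.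
rewrite rmorphM rmorphD rmorph1 /= Dt mulrDr [X in _ + X]mulrAC [t * tau t]mulrC Nt.
by ring.
Qed.

(** * Removal of the largest prime *)

Section PrimeStep.

Variable n : nat.
Hypothesis pr_p : prime n.+1.
Let p := n.+1.
Let sp := sq p.

Variable tau : aut.
Hypotheses (tau_fix : forall x, sqrtQ n x -> tau x = x) (tau_sp : tau sp = - sp).

Lemma sqrtQ_prime x : sqrtQ n.+1 x <-> adjoin (sqrtQ n) sp x.
Proof. by rewrite /sqrtQ /= pr_p. Qed.

Let sp2 : sp ^+ 2 = p%:R. Proof. exact: sqK. Qed.

Let sp0 : sp != 0.
Proof. by rewrite /sp /sq sqrtC_eq0 pnatr_eq0. Qed.

Let sqrtQ_le x : sqrtQ n x -> sqrtQ n.+1 x. Proof. exact: sqrtQ_mono. Qed.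

Let sqrtQ_sp : sqrtQ n.+1 sp. Proof. by apply/sqrtQ_prime/adjoin_gen. Qed.

Lemma tau_fixed x : sqrtQ n.+1 x -> tau x = x -> sqrtQ n x.
Proof.
case/sqrtQ_prime=> a [b [Ba Bb ->]]; rewrite rmorphD rmorphM /= (tau_fix Ba) (tau_fix Bb) tau_sp.
move=> Eab; have : 2 * (b * sp) = 0.
  transitivity (a + b * sp - (a + b * - sp)); first by ring.
  by rewrite Eab subrr.
by move/eqP; rewrite mulf_eq0 pnatr_eq0 /= => /eqP->; rewrite addr0.
Qed.

Lemma tau_anti x : sqrtQ n.+1 x -> tau x = - x -> exists2 b, sqrtQ n b & x = b * sp.
Proof.
move=> Bx tx; exists (x / sp); last by rewrite divfK.
apply: tau_fixed; first exact: subfield_div.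
by rewrite fmorph_div /= tx tau_sp invrN mulrNN.
Qed.

(** The Galois group of a multiquadratic field is abelian. *)
Lemma tau_comm (s : aut) x : sqrtQ n.+1 x -> tau (s x) = s (tau x).
Proof.
case/sqrtQ_prime=> a [b [Ba Bb ->]].
rewrite !(rmorphD, rmorphM) /= (tau_fix Ba) (tau_fix Bb) tau_sp.
rewrite (tau_fix (sqrtQ_stable s Ba)) (tau_fix (sqrtQ_stable s Bb)) rmorphN /=.
by have [->|->] := aut_sq s (sqK p); rewrite ?rmorphN /= tau_sp.
Qed.

(* [good c]: the symbol [{p, c}] is, modulo symbols in smaller primes, the
   obstruction class of an [eta] lying in [Q_D4]. *)
Definition good (c : rat) : Prop := exists eta,
  [/\ Q_D4 eta, central_sqrt n.+1 eta, sqrtQ n (eta ^+ 2) &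
    forall (s : aut) z, z ^+ 2 = ratr c ->
      tau (s eta / eta) * z = (s eta / eta) * s z].

Lemma good_sqr (u : rat) : good (u ^+ 2).
Proof.
exists 1; split=> [||| s z Dz].
- exact: subfield1 Q_D4_subfield.
- by apply: central_sqrt_base; [apply: oner_neq0 | apply: subfield1].
- by rewrite expr1n; apply: subfield1.
rewrite rmorph1 divr1 rmorph1 !mul1r.
have [->|->] : z = ratr u \/ z = - ratr u; rewrite ?rmorphN ?fmorph_rat //.
by apply: sqr_eq_sign; rewrite Dz rmorphXn.
Qed.

Lemma goodM (c d : rat) : c != 0 -> good c -> good d -> good (c * d).
Proof.
move=> c0 [x [Qx Tx Bx Dx]] [y [Qy Ty By Dy]]; exists (x * y); split.
- exact: subfieldM Q_D4_subfield _ _ Qx Qy.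
- exact: central_sqrtM.
- by rewrite exprMn; apply: subfieldM.
move=> s z Dz; pose z1 : algC := sqrtC (ratr c).
have z10 : z1 != 0 by rewrite sqrtC_eq0 fmorph_eq0.
have Dz1 : z1 ^+ 2 = ratr c by rewrite sqrtCK.
have [v Ez Dz2] : exists2 v, z = z1 * v & v ^+ 2 = ratr d.
  exists (z / z1); first by rewrite mulrCA divff ?mulr1.
  by rewrite expr_div_n Dz Dz1 rmorphM mulrC mulKf // fmorph_eq0.
have Ew : s (x * y) / (x * y) = (s x / x) * (s y / y).
  by rewrite rmorphM mulf_div.
rewrite Ew Ez; move: (Dx s z1 Dz1) (Dy s v Dz2).
move: (s x / x) (s y / y) => {}Ew w' Ex Ey.
transitivity ((tau Ew * z1) * (tau w' * v)); first by rewrite rmorphM; ring.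
by rewrite Ex Ey rmorphM /=; ring.
Qed.

Lemma good_mul_sqr (c c' u : rat) : u != 0 -> c' = c * u ^+ 2 -> good c -> good c'.
Proof.
move=> u0 -> [x [Qx Tx Bx Dx]]; exists x; split=> // s z Dz.
have u0' : ratr u != 0 :> algC by rewrite fmorph_eq0.
have Dzu : (z / ratr u) ^+ 2 = ratr c.
  by rewrite expr_div_n Dz rmorphM rmorphXn /= mulfK ?expf_neq0.
have := Dx s _ Dzu; rewrite [s (z / _)]fmorph_div /= fmorph_rat !mulrA.
by move/(congr1 (fun v => v * ratr u)); rewrite !divfK.
Qed.

Lemma sp_notB : ~ sqrtQ n sp.
Proof.
move/tau_fix; rewrite tau_sp => /eqP.
by rewrite eq_sym -addr_eq0 -mulr2n mulrn_eq0 (negPf sp0).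
Qed.

(* The Steinberg relation [{a, 1 - a} = 0]. *)
Lemma good_steinberg (a b : rat) :
    a != 0 -> 1 - a = p%:R * b -> sqrtQ n (sqrtC (ratr a)) -> sqrtQ n (sqrtC (ratr b)) ->
  good a.
Proof.
move=> a0 Dab Ba Bb; set al := sqrtC (ratr a) in Ba; set be := sqrtC (ratr b) in Bb.
have [[r <-]|na] := classic (exists r : rat, r ^+ 2 = a); first exact: good_sqr.
have al2 : al ^+ 2 = ratr a by apply: sqrtCK.
have be2 : be ^+ 2 = ratr b by apply: sqrtCK.
have E1 : 1 - ratr a = ratr (1 - a) :> algC by rewrite rmorphB rmorph1.
have Dsb : (sp * be) ^+ 2 = 1 - ratr a.
  by rewrite exprMn sp2 be2 E1 Dab rmorphM rmorph_nat.
have a1 : 1 - ratr a != 0 :> algC.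
  rewrite E1 fmorph_eq0 subr_eq0.
  by apply/eqP => a1; apply: na; exists 1; rewrite expr1n.
have be0 : be != 0.
  by apply: contraNneq a1 => b0; rewrite -Dsb b0 mulr0 expr0n.
have al0 : al != 0 by rewrite sqrtC_eq0 fmorph_eq0.
have Nal : (1 + al) * (1 - al) = (sp * be) ^+ 2 by rewrite Dsb -al2; ring.
have [al1 al1'] : 1 + al != 0 /\ 1 - al != 0.
  by apply/andP; rewrite -negb_or -mulf_eq0 Nal Dsb.
(* A conjugate of [eta] over 1 - al is, up to sign, [sp * be / eta], since (1 + al)(1 - al) = 1 - a
   = p b. Hence [s eta / eta] involves [sp] exactly when [s] moves sqrt a, which is the sign
   required by [good a]. *)
pose eta := sqrtC (1 + al); have eta2 : eta ^+ 2 = 1 + al by apply: sqrtCK.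
have eta0 : eta != 0 by rewrite sqrtC_eq0.
have Bal1 : sqrtQ n (1 + al) by apply: subfieldD => //; apply: subfield1.
have Dw (s : aut) : (s al = al /\ (s eta / eta = 1 \/ s eta / eta = -1)) \/
    (s al = - al /\ exists2 g, sqrtQ n g & s eta / eta = g * sp).
  have [sal|sal] : s al = al \/ s al = - al.
    by apply: sqr_eq_sign; rewrite -rmorphXn al2 fmorph_rat.
    left; split=> //; apply: sqr_eq_sign.
    by rewrite expr_div_n -rmorphXn eta2 rmorphD rmorph1 /= sal divff // expr1n.
  right; split=> //.
  have [Dw|Dw] : s eta / eta = be / (1 + al) * sp \/ s eta / eta = - (be / (1 + al) * sp).
    apply: sqr_eq_sign; rewrite expr_div_n -rmorphXn eta2 rmorphD rmorph1 /= sal.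
    rewrite (_ : (be / (1 + al) * sp) ^+ 2 = (sp * be) ^+ 2 / (1 + al) ^+ 2).
      by rewrite -Nal; field.
    by rewrite mulrAC expr_div_n [be * sp]mulrC.
    by exists (be / (1 + al)) => //; apply: subfield_div.
  exists (- (be / (1 + al))); last by rewrite mulNr.
  by apply: subfieldN => //; apply: subfield_div.
have Qrat_notin (r : rat) x : x != 0 -> sqrtQ n x -> ratr r <> x * sp :> algC.
  move=> x0 Bx Dr; apply: sp_notB; rewrite (_ : sp = ratr r / x).
    by apply: subfield_div => //; apply: subfield_rat.
  by rewrite Dr mulrC mulKf.
(* A rational square root of 1 - a or of a(1 - a) would put [sp] in [sqrtQ n]; this supplies the
   nonsquare conditions of [D4_mem], the case of [a] a square having been set aside. *)
have nsq (r q : rat) x : x != 0 -> sqrtQ n x -> (x * sp) ^+ 2 = ratr q -> r ^+ 2 != q.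
  move=> x0 Bx Dq; apply/eqP => Dr.
  have [] : ratr r = x * sp \/ ratr r = - (x * sp).
  - by apply: sqr_eq_sign; rewrite Dq -rmorphXn Dr.
  - exact: Qrat_notin.
  by move/(congr1 -%R); rewrite opprK -rmorphN; apply: Qrat_notin.
exists eta; split.
- apply: (@D4_mem a 1 1).
  + by move=> r; apply/eqP => Dr; apply: na; exists r.
  + move=> r; apply: (nsq r _ be) => //.
    by rewrite [be * _]mulrC Dsb !expr1n mulr1 rmorphB rmorph1.
  + move=> r; apply: (nsq r _ (al * be)); first exact: mulf_neq0.
      exact: subfieldM.
    by rewrite -mulrA exprMn [be * _]mulrC Dsb al2 !expr1n mulr1 rmorphM rmorphB rmorph1.
  by rewrite eta2 rmorph1 mul1r.
- split=> // [|s]; first by rewrite eta2; apply: sqrtQ_le.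
  have B1 : sqrtQ n.+1 1 by apply: subfield1.
  have [[_ [->|->]]|[_ [g Bg ->]]] := Dw s => //; first exact: subfieldN.
  by apply: subfieldM => //; apply: sqrtQ_le.
- by rewrite eta2.
move=> s z Dz.
have szal : s z * al = s al * z.
  by have [->|->] : z = al \/ z = - al;
    [apply: sqr_eq_sign; rewrite Dz al2 | rewrite // | rewrite rmorphN /= mulNr mulrN].
have [[sal [->|->]]|[sal [g Bg ->]]] := Dw s;
  apply: (mulIf al0); rewrite -[RHS]mulrA szal sal ?rmorph1 ?rmorphN1; try ring.
by rewrite rmorphM /= tau_fix // tau_sp; ring.
Qed.

Lemma sqrtQ_sqrt_quo (x y : int) : sqrtQ n (sq x) -> sqrtQ n (sq y) ->
  sqrtQ n (sqrtC (ratr (x%:~R / y%:~R))).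
Proof.
move=> Bx By; have Bxy : sqrtQ n (sq x / sq y) by apply: subfield_div.
have [->|->] : sqrtC (ratr (x%:~R / y%:~R)) = sq x / sq y
            \/ sqrtC (ratr (x%:~R / y%:~R)) = - (sq x / sq y) => //; last exact: subfieldN.
by apply: sqr_eq_sign; rewrite expr_div_n !sqK sqrtCK fmorph_div /= !ratr_int.
Qed.

Lemma smooth_nat (m : nat) : (0 < m < p)%N -> smooth n m.
Proof. by case/andP=> m0 mp; apply: lt_smooth => //; case: m m0 mp. Qed.

(* Tate's reduction: modulo [good] classes, only the residue of [c] matters. *)
Lemma good_reduce (c : int) : smooth n c -> exists m : nat,
  [/\ (0 < m < p)%N, (p%:Z %| c - m%:Z)%Z & good (c * m)%:~R].
Proof.
have pos (c' : nat) : (0 < c')%N -> smooth n c' -> exists m : nat,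
    [/\ (0 < m < p)%N, (c' = m %[mod p])%N & good (c' * m)%:R].
  move: c'; apply: nat_prime_ind => [_|q c0 pr_q c00 IH sm_qc].
    exists 1%N; rewrite prime_gt1 //; split=> //; exact: (good_sqr 1).
  have sm_c : smooth n c0.
    split; first by case: c0 c00 {IH sm_qc}.
    by move=> r pr_r rc; apply: sm_qc.2 => //; rewrite /= dvdn_mull.
  have le_qn : (q <= n)%N by apply: sm_qc.2 => //; rewrite /= dvdn_mulr.
  have qp : (q < p)%N by rewrite ltnS.
  have q0 := prime_gt0 pr_q.
  have [m' [/andP[m'0 m'p] Dm' Gm']] := IH sm_c.
  have pNm : ~~ (p %| q * m')%N.
    by rewrite Euclid_dvdM // negb_or !gtnNdvd.
  (* The Steinberg relation is applied to a = q m' / m, for which 1 - a = p (- k / m). Since k < p,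
     the square root of - k / m stays in [sqrtQ n]. The quotient k may be 0, in which case a = 1. *)
  pose m := (q * m' %% p)%N; pose k := (q * m' %/ p)%N.
  have Dk : (q * m' = k * p + m)%N by apply: divn_eq.
  have m0 : (0 < m)%N by rewrite lt0n.
  have mp : (m < p)%N by rewrite ltn_mod.
  have kp : (k < p)%N.
    rewrite ltn_divLR //; apply: (leq_ltn_trans (n := q * p)%N).
      by rewrite leq_mul2l (ltnW m'p) orbT.
    by rewrite ltn_pmul2r.
  exists m; rewrite m0 mp; split=> //.
    by rewrite modn_mod -modnMmr Dm' modnMmr.
  have rm0 : m%:R != 0 :> rat by rewrite pnatr_eq0 -lt0n.
  have rm'0 : m'%:R != 0 :> rat by rewrite pnatr_eq0 -lt0n.
  have Bnat (j : nat) : (j < p)%N -> sqrtQ n (sq j).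
    case: j => [_|j jp]; first by rewrite /sq sqrtC0; apply: (subfield_nat 0).
    exact: sqrtQ_smooth (smooth_nat _).
  have Gqm : good (q%:R * m'%:R / m%:R).
    apply: (@good_steinberg _ (- k%:R / m%:R)).
    - by rewrite !mulf_neq0 ?invr_eq0 // pnatr_eq0 -lt0n.
    - rewrite -natrM Dk natrD natrM; field => //.
    - rewrite -natrM; apply: (@sqrtQ_sqrt_quo (q * m')%N m); last exact: Bnat.
      by rewrite PoszM; apply: sqrtQ_sqM; apply: Bnat.
    rewrite -[- k%:R]/(- (k%:Z)%:~R) -rmorphN.
    apply: (@sqrtQ_sqrt_quo (- k%:Z) m); last exact: Bnat.
    rewrite -mulN1r; apply: sqrtQ_sqM; last exact: Bnat.
    by apply: sqrtQ_gen; apply/mem_gens; left.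
  apply: (good_mul_sqr (c := (c0 * m')%:R * (q%:R * m'%:R / m%:R)) (u := m%:R / m'%:R)).
  - by rewrite mulf_neq0 ?invr_eq0.
  - by rewrite !natrM; field; rewrite rm'0.
  by apply: goodM => //; rewrite pnatr_eq0 -lt0n muln_gt0 c00.
case=> c0 sm_c; have ad0 : (0 < `|c|)%N by rewrite absz_gt0; apply/eqP.
have sm_ac : smooth n `|c|%N by split=> //; case: `|c|%N ad0.
have [m [/andP[m0 mp] Dm Gm]] := pos _ ad0 sm_ac.
have Dm' : (p%:Z %| `|c|%N%:Z - m%:Z)%Z.
  by rewrite -eqz_mod_dvd; apply/eqP; rewrite !modz_nat Dm.
have [c1|c1] := leP 0 c.
  exists m; rewrite m0 mp; split=> //; first by rewrite -[c]gez0_abs.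
  by rewrite -{1}[c]gez0_abs // -PoszM.
(* For negative [c] the sign is absorbed by the Steinberg relation for a = - m / m1, where 1 - a = p
   / m1. *)
pose m1 := (p - m)%N.
have [m10 m1p] : (0 < m1)%N /\ (m1 < p)%N by rewrite /m1; split; lia.
exists m1; rewrite m10 m1p; split=> //.
  have -> : c - m1%:Z = - (`|c|%N%:Z - m%:Z) - p%:Z by rewrite /m1; lia.
  by rewrite rpredB ?rpredN ?dvdzz.
have rm0 : m%:R != 0 :> rat by rewrite pnatr_eq0 -lt0n.
have rm10 : m1%:R != 0 :> rat by rewrite pnatr_eq0 -lt0n.
have Dpm : p%:R = m%:R + m1%:R :> rat by rewrite -natrD /m1 subnKC // ltnW.
have Bsq (j : nat) : (0 < j < p)%N -> sqrtQ n (sq j).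
  by move=> jp; apply: sqrtQ_smooth; apply: smooth_nat.
have Gm1 : good (- m%:R / m1%:R).
  apply: (@good_steinberg _ (1%:R / m1%:R)).
  - by rewrite mulf_neq0 ?invr_eq0 ?oppr_eq0.
  - by rewrite Dpm; field.
  - rewrite -[- m%:R]/(- (m%:Z)%:~R) -rmorphN.
    apply: (@sqrtQ_sqrt_quo (- m%:Z) m1); last by apply: Bsq; rewrite m10.
    rewrite -mulN1r; apply: sqrtQ_sqM; last by apply: Bsq; rewrite m0.
    by apply: sqrtQ_gen; apply/mem_gens; left.
  apply: (@sqrtQ_sqrt_quo 1 m1); last by apply: Bsq; rewrite m10.
  by rewrite /sq sqrtC1; apply: subfield1.
apply: (good_mul_sqr (c := (`|c| * m)%:R * (- m%:R / m1%:R)) (u := m1%:R / m%:R)).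
- by rewrite mulf_neq0 ?invr_eq0.
- have Dc : c%:~R = - `|c|%N%:R :> rat.
    by rewrite -[_%:R]/((`|c|%N%:Z)%:~R) ltz0_abs // rmorphN opprK.
  by rewrite rmorphM natrM /= Dc -[m1%:~R]/(m1%:R); field; rewrite rm0.
by apply: goodM => //; rewrite pnatr_eq0 -lt0n muln_gt0 ad0.
Qed.

(** [c] and [u ^+ 2] reduce to the same [m], so [c * m] and [u ^+ 2 * m] are both good, and their
    product is [c] up to a square. *)
Lemma good_residue (c : int) (u : nat) : smooth n c -> (0 < u < p)%N ->
  (p %| `|((u%:Z) ^+ 2 - c)%R|)%N -> good c%:~R.
Proof.
move=> sm_c up pu; have sm_u := smooth_nat up.
have sm_u2 : smooth n (u%:Z ^+ 2) by rewrite expr2; apply: smoothM.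
have [m [mp Dm Gm]] := good_reduce sm_c.
have [m2 [m2p Dm2 Gm2]] := good_reduce sm_u2.
have Em : m2 = m.
  have: (p%:Z %| m2%:Z - m%:Z)%Z.
    rewrite (_ : m2%:Z - m%:Z = (u%:Z ^+ 2 - c) - (u%:Z ^+ 2 - m2%:Z) + (c - m%:Z)); last by ring.
    by apply: rpredD => //; apply: rpredB.
  rewrite -eqz_mod_dvd !modz_nat eqz_nat.
  case/andP: mp => _ mp; case/andP: m2p => _ m2p.
  by rewrite !modn_small // => /eqP.
rewrite {m2 m2p Dm2}Em in Gm2.
case/andP: mp => m0 mp; case/andP: up => u0 up.
have rm0 : m%:R != 0 :> rat by rewrite pnatr_eq0 -lt0n.
have ru0 : u%:R != 0 :> rat by rewrite pnatr_eq0 -lt0n.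
have c0 : c%:~R != 0 :> rat by rewrite intr_eq0; apply/eqP; case: sm_c.
apply: (good_mul_sqr (c := (c * m)%:~R * (u%:Z ^+ 2 * m)%:~R) (u := (u%:R * m%:R)^-1)).
- by rewrite invr_eq0 mulf_neq0.
- rewrite expr2 !rmorphM /=.
  by rewrite -[m%:~R]/(m%:R) -[u%:~R]/(u%:R); field; rewrite rm0 ru0.
apply: goodM => //.
by rewrite rmorphM mulf_neq0.
Qed.

(** The square of [tau] acts on [theta] by a sign. A minus sign, the square term at [p] of the
    quadratic form, is cancelled by a fourth root of [p]: [tau] multiplies it by a square root of
    -1, which [tau] fixes, so applying [tau] twice negates it. *)
Lemma central_sqrt_involutive theta : central_sqrt n.+1 theta -> exists eta,
  [/\ Q_D4 eta, central_sqrt n.+1 eta & tau (tau (theta * eta)) = theta * eta].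
Proof.
case=> th0 Bth Tth; have tt x : sqrtQ n.+1 x -> tau (tau x) = x.
  case/sqrtQ_prime=> a [b [Ba Bb ->]]; rewrite !(rmorphD, rmorphM) /= !(tau_fix Ba, tau_fix Bb).
  by rewrite tau_sp rmorphN /= tau_sp opprK.
have [Dth|Dth] : tau (tau theta) = theta \/ tau (tau theta) = - theta.
- by apply: sqr_eq_sign; rewrite -!rmorphXn /= tt.
- exists 1; rewrite mulr1; split=> //; first exact: subfield1 Q_D4_subfield.
  by apply: central_sqrt_base; [apply: oner_neq0 | apply: subfield1].
pose eta := sqrtC sp; have eta2 : eta ^+ 2 = sp by apply: sqrtCK.
have eta0 : eta != 0 by rewrite sqrtC_eq0.
have Bi : sqrtQ n (sq (-1)) by apply: sqrtQ_gen; apply/mem_gens; left.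
have quo2 (s : aut) : s eta / eta = 1 \/ s eta / eta = -1 \/
    (s eta / eta = sq (-1) \/ s eta / eta = - sq (-1)).
  have [Dq|Dq] : (s eta / eta) ^+ 2 = 1 \/ (s eta / eta) ^+ 2 = -1.
  - have [Ds|Ds] := aut_sq s (sqK p); rewrite expr_div_n -rmorphXn eta2 Ds.
      by left; rewrite divff.
    by right; rewrite mulNr divff.
  - have [] : s eta / eta = 1 \/ s eta / eta = -1; last by auto.
      by apply: sqr_eq_sign; rewrite Dq expr1n.
    by auto.
  by right; right; apply: sqr_eq_sign; rewrite Dq sqK rmorphN1.
have Bquo (s : aut) : sqrtQ n (s eta / eta).
  by have [->|[->|[->|->]]] := quo2 s => //; do ?apply: subfieldN => //; apply: subfield1.
have tteta : tau (tau eta) = - eta.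
  pose r := tau eta / eta; have Dr : tau eta = r * eta by rewrite divfK.
  rewrite Dr rmorphM /= Dr tau_fix; last exact: Bquo.
  rewrite (_ : r * (r * eta) = r ^+ 2 * eta); last by ring.
  by rewrite /r expr_div_n -rmorphXn eta2 tau_sp mulNr divff // mulN1r.
exists eta; split; last by rewrite !rmorphM /= Dth tteta mulrNN.
  apply: (@fourth_root_Q_D4 p%:R).
  - move=> r; apply: (@sqr_neq_odd_logn p p%:Z) => //.
    by rewrite /= (logn_prime p pr_p) eqxx.
  - move=> r; have := @sqr_neq_odd_logn p (- p%:Z) r pr_p.
    by rewrite abszN /= (logn_prime p pr_p) eqxx rmorphN; apply.
  by rewrite (exprM _ 2 2) eta2 sp2 rmorph_nat.
by split=> // [|s]; [rewrite eta2 | apply: sqrtQ_le].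
Qed.

(** The quotients [w s] form a cocycle and [tau] commutes with [s] on them, so the sign of [tau] on
    [w s] is a character in [s]; it is trivial on automorphisms fixing [sqrtQ n], and Kummer theory
    supplies [c]. *)
Lemma tau_character theta :
    central_sqrt n.+1 theta -> sqrtQ n (theta ^+ 2) ->
  exists c : int, [/\ smooth n c, (odd p -> leg p c) &
    forall s : aut, tau (s theta / theta) * sq c = s theta / theta * s (sq c)].
Proof.
case=> th0 _ Tth Bth; pose w (s : aut) := s theta / theta.
have w0 s : w s != 0 by rewrite mulf_neq0 ?invr_eq0 ?fmorph_eq0.
pose chi (s : aut) := tau (w s) != w s.
have Dw s : tau (w s) = (-1) ^+ chi s * w s.
  have [tw|tw] : tau (w s) = w s \/ tau (w s) = - w s.
  - apply: sqr_eq_sign; rewrite -rmorphXn /= tau_fix //.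
    by rewrite expr_div_n -rmorphXn; apply: subfield_div => //; apply: sqrtQ_stable.
  - by rewrite /chi tw eqxx mul1r.
  by rewrite /chi tw eq_sym -addr_eq0 -mulr2n mulrn_eq0 (negPf (w0 s)) mulN1r.
have wM (s t : aut) : w (s \o t : aut) = s (w t) * w s.
  by rewrite /w fmorph_div /= mulrA divfK // fmorph_eq0.
have nopp (z : algC) (e f : bool) : z != 0 -> (-1) ^+ e * z = (-1) ^+ f * z -> e = f.
  have n1 : (1 : algC) != -1 by rewrite -addr_eq0 -mulr2n pnatr_eq0.
  move=> z0 /(mulIf z0); case: e; case: f => // /eqP;
  by rewrite expr1 expr0 ?(eq_sym (-1)) (negPf n1).
have chiM (s t : aut) : chi (s \o t : aut) = chi s (+) chi t.
  apply: (nopp _ _ _ (w0 (s \o t : aut))); rewrite -Dw wM rmorphM /=.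
  rewrite tau_comm; last exact: Tth.
  rewrite !Dw rmorphM /= rmorph_sign signr_addb.
  by move: ((-1) ^+ chi s) ((-1) ^+ chi t) => e f; ring.
have chi1 (s : aut) : {in gens n, forall d, s (sq d) = sq d} -> chi s = false.
  move=> /msq_fix fix_s; apply/negbTE; rewrite negbK; apply/eqP.
  have [->|->] : w s = 1 \/ w s = -1; rewrite ?rmorphN ?rmorph1 //.
  apply: sqr_eq_sign; rewrite expr_div_n -rmorphXn expr1n /=.
  by rewrite fix_s // divff // expf_neq0.
have [c [c0 sm_c Dc]] := kummer_character (gens_indep n) chiM chi1.
have {}sm_c : smooth n c.
  by split=> // q pr_q /sm_c[]// d /gens_coprime; apply.
have sqc0 : sq c != 0 by rewrite /sq sqrtC_eq0 intr_eq0; apply/eqP.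
exists c; split=> // [odd_p|s]; last first.
  by rewrite -/(w s) Dw Dc; move: ((-1) ^+ chi s) => e; ring.
(* For a nonresidue [c], [tau] negates [w phi], which is therefore [b * sp] with [b] in [sqrtQ n].
   Since [phi] applied twice fixes [theta ^+ 2], the product [phi (w phi) * w phi] has square 1; it
   equals [p * (b * phi b)] up to sign, against [frobenius_norm]. *)
apply/negPn/negP => lc; have [phi [phic Nphi]] := frobenius_norm pr_p odd_p sm_c lc.
have chi_phi : chi phi by apply/(nopp _ _ true sqc0); rewrite -Dc phic mulN1r.
have [b Bb Dwb] : exists2 b, sqrtQ n b & w phi = b * sp.
  by apply: tau_anti; [apply: Tth | rewrite Dw chi_phi mulN1r].
apply: (Nphi b Bb).
have Dphi2 : (phi (w phi) * w phi) ^+ 2 = 1.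
  rewrite -(wM phi phi) /w expr_div_n -rmorphXn /=.
  rewrite (_ : phi (phi _) = theta ^+ 2) ?divff ?expf_neq0 //.
  apply: (msq_fix (nu := phi \o phi) _ Bth) => d _ /=.
  by have [Ed|Ed] := aut_sq phi (sqK d); rewrite Ed ?rmorphN /= Ed ?opprK.
rewrite -[RHS]Dphi2 Dwb rmorphM /=.
have [->|->] := aut_sq phi (sqK p); rewrite -/p -sp2 -/sp; ring.
Qed.

(** Factors from [Q_D4] remove three obstructions in turn: [tau] is made an involution on [theta],
    then fixes [theta], then fixes all its quotients, which brings the element down to level [n]. *)
Lemma central_sqrt_prime_step theta :
  (forall eta, central_sqrt n eta -> Q_D4 eta) -> central_sqrt n.+1 theta -> Q_D4 theta.
Proof.
move=> IH Tth; have div_Q x y : Q_D4 y -> y != 0 -> Q_D4 (x * y) -> Q_D4 x.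
  move=> Qy y0 Qxy; rewrite -(mulfK y0 x).
  exact: subfield_div Q_D4_subfield Qxy Qy.
have [eta [Qeta Teta tt]] := central_sqrt_involutive Tth.
have [eta0 _ _] := Teta; apply: (div_Q _ _ Qeta eta0).
have := central_sqrtM Tth Teta; move: (theta * eta) tt => th tt {eta Qeta Teta eta0 Tth}Tth.
have [th0 Bth Hth] := Tth.
have [s [Bs s0 ts]] :=
  hilbert90_involution (sqrtQ_subfield n.+1) th0 (Hth tau) tt sqrtQ_sp sp0 tau_sp.
apply: (div_Q _ _ (sqrtQ_Q_D4 Bs) s0).
have := central_sqrtM Tth (central_sqrt_base s0 Bs).
move: (th * s) ts => {th tt Tth th0 Bth Hth}th tth Tth.
have [th0 Bth Hth] := Tth.
have {}Bth : sqrtQ n (th ^+ 2) by apply: tau_fixed => //; rewrite rmorphXn /= tth.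
have [c [sm_c lc Dc]] := tau_character Tth Bth.
have pc : ~~ (p %| `|c|)%N.
  by apply/negP => /(sm_c.2 _ pr_p); rewrite ltnn.
have [u up pu] : exists2 u : nat, (0 < u < p)%N & (p %| `|((u%:Z) ^+ 2 - c)%R|)%N.
  have [odd_p|even_p] := boolP (odd p); first by apply: legP pc _; rewrite ?lc.
  (* At 2 there is no residue condition: [c] is odd, hence congruent to 1. *)
  have Dp : p = 2%N by have [//|oddp] := even_prime pr_p; case/negP: even_p.
  by exists 1%N; rewrite Dp //; move: pc; rewrite Dp; lia.
have [eta [Qeta Teta Beta Deta]] := good_residue sm_c up pu.
have [eta0 _ Heta] := Teta; apply: (div_Q _ _ Qeta eta0); apply: IH.
have sqc0 : sq c != 0 by rewrite /sq sqrtC_eq0 intr_eq0; apply/eqP; case: sm_c.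
split=> [||nu]; first exact: mulf_neq0.
  by rewrite exprMn; apply: subfieldM.
have -> : nu (th * eta) / (th * eta) = (nu th / th) * (nu eta / eta).
  by rewrite rmorphM mulf_div.
(* [tau] changes both factors by the same sign, that of [nu] on [sq c], so it fixes their
   product. *)
apply: tau_fixed; first by apply: subfieldM.
have := Deta nu (sq c); rewrite sqK ratr_int => /(_ erefl) Eeta.
apply: (mulIf (mulf_neq0 sqc0 sqc0)); rewrite rmorphM mulrACA /= Dc Eeta.
have [->|->] := aut_sq nu (sqK c); ring.
Qed.

End PrimeStep.

Lemma central_sqrt_Q_D4 n theta : central_sqrt n theta -> Q_D4 theta.
Proof.
elim: n theta => [|n IH] theta.
  (* Over Q(i), complex conjugation is an involution on all of [algC], so Hilbert 90 applies at
     once: [theta] times an element of Q(i) becomes real, and its square, real and in Q(i), is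
     rational. *)
  case=> th0 Bth Hth; pose kappa : aut := Num.conj.
  have Bi : sqrtQ 0 (sq (-1)) by apply: sqrtQ_gen; rewrite mem_head.
  have i0 : sq (-1) != 0 by rewrite /sq sqrtC_eq0 oppr_eq0 oner_neq0.
  have ki : kappa (sq (-1)) = - sq (-1).
    have [ki|//] := aut_sq kappa (sqK (-1)).
    have := mul_conjC_ge0 (sq (-1)); rewrite -[(_ ^* )%R]/(kappa _) ki -expr2 sqK.
    by rewrite rmorphN1 oppr_ge0 ler10.
  have kk x : kappa (kappa x) = x by apply: conjCK.
  have [s [Bs s0 ks]] :=
    hilbert90_involution (sqrtQ_subfield 0) th0 (Hth kappa) (kk _) Bi i0 ki.
  have QD := subfield_div Q_D4_subfield; rewrite -(mulfK s0 theta).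
  apply: QD (sqrtQ_Q_D4 Bs).
  have [a [b [Ca Cb Dab]]] : sqrtQ 0 ((theta * s) ^+ 2).
    by rewrite exprMn; apply: subfieldM => //; apply: subfieldX.
  have: kappa ((theta * s) ^+ 2) = (theta * s) ^+ 2 by rewrite rmorphXn /= ks.
  rewrite Dab rmorphD rmorphM /= (aut_Crat kappa Ca) (aut_Crat kappa Cb) ki => Eab.
  have b0 : b = 0.
    have /eqP : 2 * (b * sq (-1)) = 0.
      transitivity (a + b * sq (-1) - (a + b * - sq (-1))); first by ring.
      by rewrite Eab subrr.
    by rewrite !mulf_eq0 pnatr_eq0 (negPf i0) orbF => /eqP.
  case/CratP: Ca => q Dq; apply: (@sqrt_Q_D4 q).
  by rewrite Dab b0 mul0r addr0.
have [pr_p|npr] := boolP (prime n.+1); last first.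
  move=> Tth; apply: (IH theta); move: Tth.
  by rewrite /central_sqrt /sqrtQ /= (negPf npr).
have [nind _] : indep (n.+1%:Z :: gens n) by have := gens_indep n.+1; rewrite /= pr_p.
have [tau [tau_fix tau_sp]] := msq_flip nind.
exact: (central_sqrt_prime_step pr_p tau_fix tau_sp IH).
Qed.

(** * Groups of generalized D_4-type *)

Section GroupLaw.

Local Open Scope group_scope.

(** Stated by identities so that it passes to products, subgroups and quotients. *)
Definition central_squares (gT : finGroupType) (A : {set gT}) : Prop :=
  {in A &, forall x y, x * x * (x * x) = 1 /\ x * x * y = y * (x * x)}.

(** The group is extraspecial: squares lie in its Frattini subgroup, which is its center, of
    exponent 2. *)
Lemma central_squares_D8 : central_squares [set: gsort 'D_8].
Proof.
have esD : extraspecial [set: gsort 'D_8].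
  exact: isog_extraspecial isog_2X1p2 (pX1p2_extraspecial (isT : prime 2)).
have pD : 2.-group [set: gsort 'D_8] by rewrite /pgroup (@card_2dihedral 3 isT).
have [spD _] := esD; have [PhiZ _] := spD.
have abZ := center_special_abelem pD spD.
move=> x y Dx Dy.
have Zx2 : x * x \in 'Z([set: gsort 'D_8]).
  rewrite -PhiZ -expg2 (Phi_joing pD) mem_gen // inE; apply/orP; right.
  by rewrite (MhoE 1 pD) mem_gen //; apply/imsetP; exists x.
have [_ abZ2] := abelemP (isT : prime 2) abZ.
split; first by rewrite -expg2 abZ2.
by have /centerP[_] := Zx2; apply.
Qed.

Lemma generalized_D4_central_squares (gT : finGroupType) (G : {group gT}) :
  generalized_D4_type G -> central_squares G.
Proof.
case=> n [H [N [_ isoG]]].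
have csH : central_squares (H : {set _}).
  move=> x y _ _; split; apply/ffunP => i.
    by have [D1 _] := central_squares_D8 (in_setT (x i)) (in_setT (y i)); rewrite !ffunE.
  by have [_ D2] := central_squares_D8 (in_setT (x i)) (in_setT (y i)); rewrite !ffunE.
have csQ : central_squares (H / N).
  move=> _ _ /morphimP[x Nx Hx ->] /morphimP[y Ny Hy ->].
  have [D1 D2] := csH x y Hx Hy.
  by rewrite -!morphM ?groupM // D1 D2 morph1.
have [f injf Df] := isogP isoG; move=> x y Gx Gy.
have fQ z : z \in G -> f z \in H / N by move=> Gz; rewrite -Df mem_morphim.
have [D1 D2] := csQ _ _ (fQ x Gx) (fQ y Gy).
split; apply: (injmP injf); rewrite ?groupM ?group1 ?morphM ?groupM ?morph1 //.
Qed.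

End GroupLaw.

(** * Fields whose Galois group has central squares of order at most 2 *)

Section Eigen.

Variable L : splittingFieldType rat.
Local Notation gal := (gal_of {:L}%AS).

(* Simultaneous diagonalization of commuting involutions on [Z]. *)
Lemma eigenvector_ind (us : seq gal) (Z P : L -> Prop) :
    (forall x y, Z x -> Z y -> Z (x + y)) -> (forall (a : rat) x, Z x -> Z (a *: x)) ->
    (forall x y, P x -> P y -> P (x + y)) ->
    {in us, forall u : gal, forall x, Z x -> Z (u x) /\ u (u x) = x} ->
    {in us &, forall u v : gal, forall x, Z x -> u (v x) = v (u x)} ->
    (forall x, Z x -> {in us, forall u : gal, u x = x \/ u x = - x} -> P x) ->
  forall x, Z x -> P x.
Proof.
move=> ZD ZZ PD; elim: us => [|u us IH] inv comm eigP; first by move=> x Zx; apply: eigP.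
have usS v : v \in us -> v \in u :: us by rewrite inE orbC => ->.
apply: IH => [v usv|v w usv usw|x Zx eigx].
- by apply: inv; apply: usS.
- by apply: comm; apply: usS.
have uu : u \in u :: us by apply: mem_head.
have [Zux uux] := inv u uu x Zx.
have half (e : rat) : e ^+ 2 = 1 -> P (2^-1 *: (x + e *: u x)).
  move=> e2; apply: eigP; first exact: ZZ (ZD _ _ Zx (ZZ _ _ Zux)).
  move=> v; rewrite inE => /predU1P[->|usv].
    have [->|->] : e = 1 \/ e = -1 by apply: sqr_eq_sign; rewrite expr1n.
      by left; rewrite scale1r linearZ linearD /= uux addrC.
    by right; rewrite scaleN1r linearZ linearB /= uux -scalerN opprB.
  rewrite !linearZ linearD linearZ /= (comm v u (usS v usv) uu x Zx).
  have [->|->] := eigx v usv; first by left.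
  by right; rewrite rmorphN /= [e *: - _]scalerN -opprD scalerN.
rewrite (_ : x = 2^-1 *: (x + 1 *: u x) + 2^-1 *: (x + (-1) *: u x)).
  by apply: PD; apply: half; rewrite ?sqrrN expr1n.
rewrite -scalerDr scale1r scaleN1r addrACA subrr addr0 -mulr2n.
by rewrite -scaler_nat scalerA mulVf ?scale1r.
Qed.

Lemma gal_fixed_rat (z : L) : (forall u : gal, u z = z) -> exists q : rat, z = q%:A.
Proof.
move=> fixz; have: z \in 1%AS; last by case/vlineP=> q ->; exists q.
rewrite -(galois_fixedField (splitting_rat_galois L)).
by apply/fixedFieldP => [|u _]; [apply: memvf | apply: fixz].
Qed.

Variable g : {rmorphism L -> algC}.
Hypothesis csG : central_squares 'Gal({:L} / 1%AS)%g.

Let mem_gal (u : gal) : u \in 'Gal({:L} / 1%AS)%g.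
Proof. by rewrite gal_kHom ?sub1v // k1HomE ahomWin. Qed.

Lemma gal_aut (nu : aut) : exists u : gal, forall x, nu (g x) = g (u x).
Proof.
have [nuL DnuL] := restrict_aut_to_normal_num_field g nu.
have hom_nu: kHom 1 {:L} (linfun nuL).
  rewrite k1HomE; apply/ahom_inP.
  by split=> [u v | ]; rewrite !lfunE ?rmorphM ?rmorph1.
have [|u _ Du] := kHom_to_gal _ (normalFieldf 1) hom_nu; first by rewrite !subvf.
by exists u => x; rewrite -DnuL -Du ?memvf // lfunE.
Qed.

Lemma sqrt_rat_mem_sqrtQ (z : algC) (q : rat) : z ^+ 2 = ratr q -> exists n, sqrtQ n z.
Proof.
move=> Dz; have [q0|q0] := eqVneq q 0.
  exists 0%N; have /eqP : z ^+ 2 = 0 by rewrite Dz q0 rmorph0.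
  by rewrite expf_eq0 => /eqP ->; apply: (subfield_nat 0 (sqrtQ_subfield 0)).
pose n := maxn `|numq q| `|denq q|; exists n.
have Bnum : sqrtQ n (sq (numq q)).
  apply/sqrtQ_smooth/lt_smooth; last exact: leq_maxl.
  by apply/eqP; rewrite numq_eq0.
have Bden : sqrtQ n (sq (denq q)).
  by apply/sqrtQ_smooth/lt_smooth; [apply/eqP/denq_neq0 | apply: leq_maxr].
have Bq : sqrtQ n (sq (numq q) / sq (denq q)) by apply: subfield_div.
have [->|->] : z = sq (numq q) / sq (denq q) \/ z = - (sq (numq q) / sq (denq q)).
- by apply: sqr_eq_sign; rewrite expr_div_n !sqK Dz.
- by [].
exact: subfieldN.
Qed.

Let fixed_squares (z : L) : Prop := forall u : gal, u (u z) = z.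

(** On the elements fixed by all squares the Galois group acts by commuting involutions, and a
    simultaneous eigenvector has a rational square. *)
Lemma fixed_squares_sqrtQ z : fixed_squares z -> exists n, sqrtQ n (g z).
Proof.
have Zlin (u : gal) x : fixed_squares x -> fixed_squares (u x).
  move=> Zx v; have [_ Duv] := csG (mem_gal v) (mem_gal u).
  have /(congr1 (fun w : gal => w x)) := Duv.
  by rewrite !galM ?memvf // Zx => <-.
move: z; apply: (eigenvector_ind (us := enum {: gal}) (Z := fixed_squares)
   (P := fun x => exists n, sqrtQ n (g x))).
- by move=> x y Zx Zy u; rewrite !rmorphD /= Zx Zy.
- by move=> a x Zx u; rewrite !linearZ /= Zx.
- move=> x y [m Bx] [n By]; exists (maxn m n); rewrite rmorphD.
  apply: subfieldD => //; first exact: sqrtQ_mono (leq_maxl m n) Bx.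
  exact: sqrtQ_mono (leq_maxr m n) By.
- by move=> u _ x Zx; split; [apply: Zlin | apply: Zx].
- move=> u v _ _ x Zx.
  have Evuvu : v (u (v (u x))) = x by have := Zx (u * v)%g; rewrite !galM ?memvf.
  have Zvu := Zlin v _ (Zlin u _ Zx).
  by rewrite -[in LHS]Evuvu (Zlin u _ Zvu) Zvu.
move=> x Zx eigx; have [q Dq] : exists q : rat, x ^+ 2 = q%:A.
  apply: gal_fixed_rat => u; rewrite rmorphXn /=.
  by have [||] := eigx u; rewrite ?mem_enum // => ->; rewrite ?sqrrN.
by apply: (@sqrt_rat_mem_sqrtQ _ q); rewrite -rmorphXn Dq /= alg_num_field fmorph_rat.
Qed.

(** The squares of the Galois group are commuting involutions, so [x] may be taken to be an
    eigenvector of all of them. Then [x ^+ 2] and, squares being central, every [u x / x] are fixed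
    by the squares, hence multiquadratic, and [x] is a [central_sqrt]. *)
Lemma central_squares_Q_D4 (x : L) : Q_D4 (g x).
Proof.
have QD := @subfieldD Q_D4 _ _ Q_D4_subfield.
apply: (eigenvector_ind (us := [seq (u * u)%g | u <- enum {: gal}]) (Z := fun=> True)
   (P := fun x => Q_D4 (g x))) => // [y z Qy Qz|u|u v|{}x _ eigx].
- by rewrite rmorphD; apply: QD.
- case/mapP=> v _ -> y _; split=> //.
  have [D1 _] := csG (mem_gal v) (mem_gal v).
  by have /(congr1 (fun w : gal => w y)) := D1; rewrite galM ?memvf // gal_id.
- case/mapP=> u' _ -> /mapP[v' _ ->] y _.
  have [_ D2] := csG (mem_gal u') (mem_gal (v' * v')%g).
  by have /(congr1 (fun w : gal => w y)) := D2; rewrite !(galM (_ * _)%g) ?memvf.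
have [->|x0] := eqVneq x 0.
  by rewrite rmorph0; apply: (subfield_nat 0 Q_D4_subfield).
have {}eigx (u : gal) : u (u x) = x \/ u (u x) = - x.
  rewrite -galM ?memvf //; apply: eigx; apply/mapP; exists u => //.
  by rewrite mem_enum.
have [n0 Bx2] : exists n, sqrtQ n (g (x ^+ 2)).
  apply: fixed_squares_sqrtQ => u; rewrite !rmorphXn /=.
  by have [->|->] := eigx u; rewrite ?sqrrN.
have Bw (u : gal) : exists n, sqrtQ n (g (u x / x)).
  apply: fixed_squares_sqrtQ => v; rewrite !fmorph_div /=.
  have [_ D2] := csG (mem_gal v) (mem_gal u).
  have /(congr1 (fun w : gal => w x)) := D2; rewrite !galM ?memvf // => <-.
  have [->|->] := eigx v; first by [].
  by rewrite rmorphN /= mulNr invrN mulrN opprK.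
have [N BN] : exists N, forall u : gal, sqrtQ N (g (u x / x)).
  have [nu Bnu] := fin_all_exists Bw.
  exists (\max_u nu u) => u; apply: sqrtQ_mono (Bnu u); exact: leq_bigmax.
apply: (@central_sqrt_Q_D4 (maxn n0 N)); split.
- by rewrite fmorph_eq0.
- by rewrite -rmorphXn; apply: sqrtQ_mono Bx2; apply: leq_maxl.
move=> nu; have [u ->] := gal_aut nu; rewrite -fmorph_div.
by apply: sqrtQ_mono (BN u); apply: leq_maxr.
Qed.

End Eigen.

(** A primitive element is sent to a root in [algC] of its minimal polynomial; [kill] makes the
    value independent of the polynomial picked by [xchoose]. *)
Lemma algC_embedding (L : splittingFieldType rat) : inhabited {rmorphism L -> algC}.
Proof.
have sepL : separable 1%AS {:L}%AS by have /and3P[] := splitting_rat_galois L.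
pose z := separable_generator 1%AS {:L}%AS.
have genL : {:L}%VS = <<1; z>>%VS.
  exact: eq_adjoin_separable_generator sepL (subvf _).
have [q Dq] : exists q : {poly rat}, minPoly 1%AS z = map_poly (GRing.in_alg L) q.
  by apply/polyOver1P/minPolyOver.
have [al al0] : exists al : algC, root (map_poly ratr q) al.
  apply: closed_rootP; rewrite size_map_poly -(size_map_poly (GRing.in_alg L)) -Dq.
  by rewrite size_minPoly.
have kill p : (map_poly (GRing.in_alg L) p).[z] = 0 -> (map_poly ratr p).[al] = 0.
  move=> pz; have : minPoly 1%AS z %| map_poly (GRing.in_alg L) p.
    by apply: minPoly_dvdp; [apply/polyOver1P; exists p | apply/rootP].
  rewrite Dq dvdp_map => /dvdpP[r ->].
  by rewrite rmorphM hornerM (rootP al0) mulr0.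
have reprP x : exists p, x == (map_poly (GRing.in_alg L) p).[z].
  have : x \in <<1; z>>%VS by rewrite -genL memvf.
  by case/Fadjoin_polyP=> _ /polyOver1P[p ->] ->; exists p.
pose h x := (map_poly ratr (xchoose (reprP x))).[al].
have hE x p : x = (map_poly (GRing.in_alg L) p).[z] -> h x = (map_poly ratr p).[al].
  move=> Dx; apply/eqP; rewrite -subr_eq0 -hornerN -hornerD -rmorphB kill //.
  by rewrite rmorphB hornerD hornerN -Dx -(eqP (xchooseP (reprP x))) subrr.
have hB : zmod_morphism h.
  move=> x y; rewrite (hE _ (xchoose (reprP x) - xchoose (reprP y))).
    by rewrite rmorphB hornerD hornerN.
  by rewrite rmorphB hornerD hornerN -!(eqP (xchooseP (reprP _))).
have hM : monoid_morphism h.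
  split; first by rewrite (hE _ 1) ?rmorph1 ?hornerC.
  move=> x y; rewrite (hE _ (xchoose (reprP x) * xchoose (reprP y))).
    by rewrite rmorphM hornerM.
  by rewrite rmorphM hornerM -!(eqP (xchooseP (reprP _))).
pose haM := GRing.isZmodMorphism.Build _ _ h hB.
pose hmM := GRing.isMonoidMorphism.Build _ _ h hM.
pose hRM : {rmorphism L -> algC} := HB.pack h haM hmM.
exact: inhabits hRM.
Qed.

Lemma isog_D8_generalized (gT : finGroupType) (G : {group gT}) :
  (G \isog 'D_8)%g -> generalized_D4_type G.
Proof.
move=> isoG; exists 1%N, [group of [set: {dffun forall i : 'I_1, gsort 'D_8}]]%g, 1%G.
split; first exact: normal1.
apply: isog_trans isoG (isog_trans _ (quotient1_isog _)).
pose d (x : gsort 'D_8) : {dffun forall i : 'I_1, gsort 'D_8} := [ffun=> x].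
have dM : {in [set: gsort 'D_8] &, {morph d : x y / (x * y)%g}}.
  by move=> x y _ _; apply/ffunP => i; rewrite !ffunE.
apply/isogP; exists (Morphism dM) => /=.
  by apply/injmP => x y _ _ /ffunP/(_ ord0); rewrite !ffunE.
apply/setP => y; rewrite inE; apply/morphimP.
exists (y ord0); rewrite ?inE //.
by apply/ffunP => i; rewrite !ffunE ord1.
Qed.

Lemma Q_D4_inftyE x : Q_D4_infty x <-> Q_D4 x.
Proof.
split=> [inf_x|Qx F sfF genF].
  apply: inf_x => [|K [M [[f Df] [L [i [[_ _] gD4]]]]] y /Df[z ->]].
    exact: Q_D4_subfield.
  have csG := generalized_D4_central_squares gD4.
  have [g] := algC_embedding L.
  (* The embedding [f] need not be the composite of [i] and [g]. But [f z] is a root of the minimal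
     polynomial of [i z], which splits in [L], so [f z] lies in the image of [g] anyway. *)
  have [q Dq] : exists q : {poly rat}, minPoly 1%AS (i z) = map_poly (GRing.in_alg L) q.
    by apply/polyOver1P/minPolyOver.
  have [r /eqP Dr] := splitting_field_normal 1%AS (i z).
  have qz : root (map_poly (GRing.in_alg M) q) z.
    rewrite -(fmorph_root i) -map_poly_comp (eq_map_poly (g := GRing.in_alg L)).
      by rewrite -Dq root_minPoly.
    by move=> a /=; rewrite !alg_num_field fmorph_rat.
  have : root (map_poly ratr q) (f z).
    rewrite -(eq_map_poly (f := f \o GRing.in_alg M)); last first.
      by move=> a /=; rewrite !alg_num_field fmorph_rat.
    by rewrite map_poly_comp fmorph_root.
  rewrite -(eq_map_poly (f := g \o GRing.in_alg L)); last first.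
    by move=> a /=; rewrite !alg_num_field fmorph_rat.
  rewrite map_poly_comp -Dq Dr (_ : map_poly g _ = \prod_(y <- map g r) ('X - y%:P)).
    rewrite root_prod_XsubC => /mapP[t _ ->].
    exact: central_squares_Q_D4.
  by rewrite big_map rmorph_prod; apply: eq_bigr => t _; apply: map_polyXsubC.
apply: Qx sfF _ => K [L [copyK galL isoL]]; apply: genF.
(* A D_4 field is its own Galois closure. *)
exists L; split=> //; exists L, (idfun : {rmorphism L -> L}); split.
  split=> // E EL _; apply/val_inj/eqP; rewrite /= eqEsubv subvf.
  by apply/subvP => z _; apply: EL.
exact: isog_D8_generalized.
Qed.

Theorem theorem1p3 (E : elliptic_curve rat) (P : point algC) :
  torsion_point E Q_D4 P <-> torsion_point E Q_D4_infty P.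
Proof.
split=> -[onP inP tP]; split=> //; case: P inP {onP tP} => //= x y [Fx Fy].
  by rewrite !Q_D4_inftyE.
by rewrite -!Q_D4_inftyE.
Qed.
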